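(* Let $n\in\mathbb{N}$ and $0<\gamma<n$, and let $B$ be a Young function. Consider the condition $$\int_0\frac{B(s)}{s^{n/(n-\gamma)+1}}\,ds<\infty.\qquad(\ast)$$ (a) If $B$ satisfies $(\ast)$, then $B_{n/\gamma}$ (defined in the context) is a Young function for which $M_\gamma:L^{B_{n/\gamma}}(\mathbb{R}^n)\to L^B(\mathbb{R}^n)$, and $L^{B_{n/\gamma}}(\mathbb{R}^n)$ is the largest Orlicz space with this property; that is, whenever $A$ is a Young function with $M_\gamma:L^A(\mathbb{R}^n)\to L^B(\mathbb{R}^n)$, one has $L^A(\mathbb{R}^n)\to L^{B_{n/\gamma}}(\mathbb{R}^n)$. (b) In addition, if $i_B>\frac{n}{n-\gamma}$, then $B$ satisfies $(\ast)$ and $$B_{n/\gamma}^{-1}(t)\simeq t^{\gamma/n}B^{-1}(t),\quad t>0.$$ (c) Conversely, if $(\ast)$ fails, then there is no Orlicz space $L^A(\mathbb{R}^n)$ for which $M_\gamma:L^A(\mathbb{R}^n)\to L^B(\mathbb{R}^n)$.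
   Context: A Young function is a convex, left-continuous function $A:[0,\infty)\to[0,\infty]$ with $A(0)=0$ which is not constant on $(0,\infty)$ (i.e. neither identically $0$ nor identically $\infty$ there). For a nondecreasing $\Phi:[0,\infty)\to[0,\infty]$, $\Phi^{-1}(s)=\inf\{t\ge0:\Phi(t)>s\}$ (with $\inf\emptyset=\infty$) denotes its generalized right-continuous inverse. The Orlicz space $L^A(\mathbb{R}^n)$ consists of the measurable functions $f$ on $\mathbb{R}^n$ with $\int_{\mathbb{R}^n}A(|f(x)|/\lambda)\,dx<\infty$ for some $\lambda>0$, with the Luxemburg norm $\|f\|_{L^A(\mathbb{R}^n)}=\inf\{\lambda>0:\int_{\mathbb{R}^n}A(|f(x)|/\lambda)\,dx\le1\}$. An arrow $L^A(\mathbb{R}^n)\to L^B(\mathbb{R}^n)$ without an operator denotes continuous inclusion. The fractional maximal operator is $M_\gamma f(x)=\sup_{Q\ni x}|Q|^{\gamma/n-1}\int_Q|f(y)|\,dy$, $x\in\mathbb{R}^n$, for locally integrable $f$, the supremum being over all cubes $Q$ containing $x$ with sides parallel to the coordinate axes. The notation $M_\gamma:L^A(\mathbb{R}^n)\to L^B(\mathbb{R}^n)$ means that there is $C>0$ with $\|M_\gamma f\|_{L^B(\mathbb{R}^n)}\le C\|f\|_{L^A(\mathbb{R}^n)}$ for all $f\in L^A(\mathbb{R}^n)$. Construction of $B_{n/\gamma}$: if $\int_0\frac{B(s)}{s^{n/(n-\gamma)+1}}ds<\infty$, i.e. the integral converges over some interval $(0,\delta)$, set $F_{n/\gamma}(t)=t^{n/(n-\gamma)}\int_0^t\frac{B(s)}{s^{n/(n-\gamma)+1}}ds\in[0,\infty]$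 (value $0$ at $t=0$), $E_{n/\gamma}(t)=t^{\gamma/n}F_{n/\gamma}^{-1}(t)$, and $B_{n/\gamma}(t)=\int_0^t\frac{E_{n/\gamma}^{-1}(s)}{s}\,ds$ for $t\ge0$. Lower Boyd index: for a Young function $B$, let $h_B(t)=\sup_{0<s<\infty}\frac{B^{-1}(st)}{B^{-1}(s)}$ for $t>0$, and $i_B=\sup_{1<t<\infty}\frac{\log t}{\log h_B(t)}$, the quotient being read as $\infty$ when $h_B(t)=1$. The relation $L\simeq R$ means that $L$ and $R$ bound each other up to positive multiplicative constants independent of $t$. *)

(* Defs.v *)
From HB Require Import structures.
From mathcomp Require Import all_boot all_order all_algebra.
From mathcomp Require Import all_classical all_reals all_analysis.
From mathcomp Require Import measurable_realfun.

Set Implicit Arguments.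
Unset Strict Implicit.
Unset Printing Implicit Defensive.

Import Order.TTheory GRing.Theory Num.Theory.
Import numFieldNormedType.Exports.

Local Open Scope classical_set_scope.
Local Open Scope ring_scope.

Section lebesgue_Rn.
Variable R : realType.
Local Notation T := (measurableTypeR R).
Local Open Scope ereal_scope.

Definition cons_pair n (p : T * n.-tuple T) : n.+1.-tuple T :=
  [tuple of p.1 :: p.2].

Lemma measurable_cons_pair n :
  measurable_fun [set: T * n.-tuple T] (@cons_pair n).
Proof. exact: measurable_cons. Qed.

(* Lebesgue measure on the Borel sets of R^n, as the n-fold product of the
   one-dimensional Lebesgue measure. *)
Fixpoint borel_lebesgue n : set (n.-tuple T) -> \bar R :=
  match n return set (n.-tuple T) -> \bar R with
  | 0 => \d_([tuple] : 0.-tuple T)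
  | n'.+1 =>
      pushforward (@lebesgue_measure R \x @borel_lebesgue n') (@cons_pair n')
  end.

Lemma borel_lebesgue_sigma_finite n :
  exists m : {sigma_finite_measure set (n.-tuple T) -> \bar R},
    @borel_lebesgue n = m :> (set _ -> _).
Proof.
elim: n => [|n [m E]] /=.
  by exists (\d_([tuple] : 0.-tuple T) : {sigma_finite_measure set _ -> \bar R}).
rewrite E.
pose prod : {measure set (T * n.-tuple T)%type -> \bar R} :=
  (@lebesgue_measure R \x m).
pose mu : {measure set (n.+1.-tuple T) -> \bar R} :=
  measure_function_pushforward__canonical__measure_function_Measure prod
    (measurable_cons_pair (n:=n)).
have sfprod : sigma_finite setT prod.
  have /sigma_finiteP[F [TF ndF Foo]] := sigma_finiteT (@lebesgue_measure R).
  have /sigma_finiteP[G [TG ndG Goo]] := sigma_finiteT m.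
  exists (fun k => F k `*` G k).
    rewrite -setXTT TF TG predeqE => -[x y]; split.
      move=> [/= [k _ Fkx] [l _ Gly]]; exists (maxn k l) => //; split.
      - by move: x Fkx; exact/subsetPset/ndF/leq_maxl.
      - by move: y Gly; exact/subsetPset/ndG/leq_maxr.
    by move=> [k _ []/= ? ?]; split; exists k.
  move=> k; have [? ?] := Foo k; have [? ?] := Goo k.
  split; first exact: measurableX.
  by rewrite /prod /= product_measure1E// lte_mul_pinfty// ge0_fin_numE.
have sf : sigma_finite setT mu.
  have [F TF mF] := sfprod.
  pose u (x : n.+1.-tuple T) : T * n.-tuple T :=
    (tnth x ord0, [tuple of behead x]).
  have mu_ : measurable_fun setT u.
    apply/measurable_fun_pair; first exact: measurable_tnth.
    exact: measurable_behead.
  have uK : cancel (@cons_pair n) u.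
    move=> [a v]; rewrite /u /cons_pair /= tnth0; congr (_, _).
    exact/val_inj.
  exists (fun i => u @^-1` F i).
    by rewrite -preimage_bigcup -TF preimage_setT.
  move=> i; split.
    by rewrite -[X in measurable X]setTI; apply: mu_ => //; exact: (mF i).1.
  rewrite /= /pushforward -comp_preimage.
  rewrite (_ : u \o _ = id); last by apply/funext => x; exact: uK.
  exact: (mF i).2.
pose sm := Measure_isSigmaFinite.Build _ _ _ mu sf.
pose sfm : {sigma_finite_measure set (n.+1.-tuple T) -> \bar R} :=
  HB.pack (mu : set _ -> \bar R) (Measure.class mu) sm.
by exists sfm.
Qed.

HB.instance Definition _ n :=
  let m := projT1 (cid (borel_lebesgue_sigma_finite n)) in
  let E := projT2 (cid (borel_lebesgue_sigma_finite n)) in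
  isMeasure.Build _ _ _ (@borel_lebesgue n)
    (eq_ind_r (fun f => f set0 = 0) (measure0 m) E)
    (eq_ind_r (fun f => forall A, 0 <= f A) (measure_ge0 m) E)
    (eq_ind_r (fun f => semi_sigma_additive f)
       (@measure_semi_sigma_additive _ _ _ m) E).

HB.instance Definition _ n :=
  let m := projT1 (cid (borel_lebesgue_sigma_finite n)) in
  let E := projT2 (cid (borel_lebesgue_sigma_finite n)) in
  Measure_isSigmaFinite.Build _ _ _ (@borel_lebesgue n)
    (eq_ind_r (fun f => sigma_finite setT f) (sigma_finiteT m) E).

(* R^n with the sigma-algebra of Lebesgue measurable sets, and Lebesgue measure
   on it. *)
Definition Rn n := caratheodory_type (@borel_lebesgue n)^*%mu.

HB.instance Definition _ n := Measurable.on (Rn n).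

Definition lebesgue_Rn n : set (Rn n) -> \bar R :=
  @completed_measure_extension _ _ _ (@borel_lebesgue n).

HB.instance Definition _ n := Measure.on (@lebesgue_Rn n).

HB.instance Definition _ n := Measure_isSigmaFinite.Build _ _ _ (@lebesgue_Rn n)
  (completed_measure_extension_sigma_finite (sigma_finiteT (@borel_lebesgue n))).

Definition coord n (x : Rn n) (i : 'I_n) : R := tnth (x : n.-tuple T) i.

End lebesgue_Rn.

Section young.
Variable R : realType.
Local Open Scope ereal_scope.
Implicit Types (A B : R -> \bar R).

(* Functions on [0, +oo[ are represented by functions on R, whose values at
   negative arguments are irrelevant. *)
Definition young_function A :=
  [/\ (forall t, (0 <= t)%R -> 0 <= A t) /\ A 0%R = 0,
      forall (p x y : R), (0 <= p <= 1)%R -> (0 <= x)%R -> (0 <= y)%R ->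
        A (p * x + (1 - p) * y)%R <= p%:E * A x + (1 - p)%:E * A y,
      forall t, (0 < t)%R -> A x @[x --> t^'-] --> A t
    & ~ exists c, forall t, (0 < t)%R -> A t = c].

(* Generalized right-continuous inverse; ereal_inf set0 = +oo. *)
Definition ginv A (s : R) : \bar R :=
  ereal_inf [set t%:E | t in [set t | (0 <= t)%R /\ s%:E < A t]].

(* A at an extended argument x >= 0, with A(+oo) = lim_{t -> +oo} A(t) = +oo. *)
Definition young_ext A (x : \bar R) : \bar R :=
  if x is r%:E then A r else +oo.

End young.

Section orlicz.
Variables (R : realType) (n : nat).
Local Open Scope ereal_scope.
Implicit Types (A B : R -> \bar R) (f : Rn R n -> \bar R).

Definition orlicz_modular A f (l : R) : \bar R :=
  \int[@lebesgue_Rn R n]_x young_ext A (`|f x| / l%:E).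

Definition in_orlicz A f : Prop :=
  measurable_fun [set: Rn R n] f /\
  exists2 l : R, (0 < l)%R & orlicz_modular A f l < +oo.

Definition luxemburg A f : \bar R :=
  ereal_inf [set l%:E | l in [set l | (0 < l)%R /\ orlicz_modular A f l <= 1]].

Definition orlicz_embedding A B : Prop :=
  (forall f, in_orlicz A f -> in_orlicz B f) /\
  exists2 C : R, (0 < C)%R &
    forall f, in_orlicz A f -> luxemburg B f <= C%:E * luxemburg A f.

Definition cube (Q : set (Rn R n)) : Prop :=
  exists (a : 'I_n -> R) (l : R), (0 < l)%R /\
    Q = [set x | forall i, (a i <= coord x i <= a i + l)%R].

Definition frac_maximal (gamma : R) f (x : Rn R n) : \bar R :=
  ereal_sup [set (fine (@lebesgue_Rn R n Q) `^ (gamma / n%:R - 1))%:E *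
                 \int[@lebesgue_Rn R n]_(y in Q) `|f y|
            | Q in [set Q | cube Q /\ Q x]].

Definition frac_maximal_bounded (gamma : R) A B : Prop :=
  exists2 C : R, (0 < C)%R &
    forall f, in_orlicz A f ->
      luxemburg B (frac_maximal gamma f) <= C%:E * luxemburg A f.

End orlicz.

Section optimal_domain.
Variables (R : realType) (n : nat) (gamma : R) (B : R -> \bar R).
Local Open Scope ereal_scope.

Definition crit_exp : R := (n%:R / (n%:R - gamma))%R.

Definition weighted_integral (t : R) : \bar R :=
  \int[@lebesgue_measure R]_(s in `]0%R, t[) (B s / (s `^ (crit_exp + 1))%:E).

Definition converges_at_0 : Prop :=
  exists2 delta : R, (0 < delta)%R & weighted_integral delta < +oo.

Definition F_fun (t : R) : \bar R :=
  (t `^ crit_exp)%:E * weighted_integral t.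

Definition E_fun (t : R) : \bar R := (t `^ (gamma / n%:R))%:E * ginv F_fun t.

Definition optimal_young (t : R) : \bar R :=
  \int[@lebesgue_measure R]_(s in `]0%R, t[) (ginv E_fun s / s%:E).

End optimal_domain.

Section boyd.
Variables (R : realType) (B : R -> \bar R).
Local Open Scope ereal_scope.

Definition dilation (t : R) : \bar R :=
  ereal_sup [set ginv B (s * t)%R / ginv B s | s in [set s | (0 < s)%R]].

Definition lower_boyd : \bar R :=
  ereal_sup [set if dilation t == 1 then +oo else (ln t)%:E / lne (dilation t)
            | t in [set t | (1 < t)%R]].

End boyd.

Definition equiv_pos (R : realType) (L G : R -> \bar R) : Prop :=
  exists c C : R, [/\ (0 < c)%R, (0 < C)%R &
    forall t, (0 < t)%R -> (c%:E * G t <= L t /\ L t <= C%:E * G t)%E].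

(* Main.v *)
(* Write p = n/(n-gamma), W(t) = int_0^t B(s) s^(-p-1) ds and F = t^p W.  As F(t)
   / t^p is nondecreasing, E(t) = t^(gamma/n) F^-1(t) satisfies E(k t) <= k E(t)
   for k >= 1, so E^-1(s)/s is nondecreasing and its primitive D is a Young
   function whose inverse is equivalent to E.
   Boundedness on L^D: if the modular of f is at most 1, a cube Q on which the
   fractional average exceeds 4T has |Q| F(T) <= 1, and discarding the part of
   f below the level s = 2 T F(T)^(gamma/n) leaves |Q| <= (1/s) int_Q |f|
   1_{|f|>s}.  A Vitali argument gives a weak-type estimate, linear in the upper
   part of f.  Summed over dyadic levels against B(2^k) <= C 2^(kp)
   (W(2^(k+1)) - W(2^k)), it telescopes to W(T)^(1/p), which is controlled by D.
   Necessity: testing M on multiples of the indicator of one cube and summing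
   over the shells of its dyadic dilates gives F(c y r^(-gamma/n)) <= r as soon
   as A(y) <= r.  This forces convergence at 0, and it says c y <= E(r), hence
   D(c y / 2) <= A(y).
   Boyd index: i_B > p yields B(h x) >= t B(x) with h^p < t, whence F <= M B by
   a geometric series, while B(x) <= F(4 x) always holds. *)
Require Import Defs.
From HB Require Import structures.
From mathcomp Require Import all_boot all_order all_algebra.
From mathcomp Require Import all_classical all_reals all_analysis.
From mathcomp Require Import measurable_realfun ring lra zify.

Set Implicit Arguments.
Unset Strict Implicit.
Unset Printing Implicit Defensive.

Import Order.TTheory GRing.Theory Num.Theory.
Import numFieldNormedType.Exports.

Local Open Scope classical_set_scope.
Local Open Scope ring_scope.
Local Open Scope ereal_scope.

(** * Boxes in Euclidean space *)

(** The maximal function is never shown to be measurable. Integrals of nonnegative functions are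
    compared through their definition as suprema over simple functions ([ge0_le_lower_integral]),
    and its superlevel sets are enclosed in measurable unions of rational cubes. [B], [W] and [F]
    may take the value [+oo]; increments of [W] are therefore stated additively, and scales with
    infinite [F] are treated apart. The telescoping rests on 1 + p gamma/n = p: it turns the
    truncation level s at T into 2 T^p W(T)^(gamma/n), so that B(T/2) / s is at most the increment
    W(T) - W(T/2) divided by W(T)^(1 - 1/p), a discrete derivative of W^(1/p). At a height y = |f x|
    only the scales with level below y contribute, and the largest of them controls the whole
    sum. *)

Lemma ge0_le_lower_integral d (T : measurableType d) (R : realType)
    (mu : {measure set T -> \bar R}) (D : set T) (f g : T -> \bar R) :
    (forall x, D x -> 0 <= f x) -> (forall x, D x -> f x <= g x) ->
  \int[mu]_(x in D) f x <= \int[mu]_(x in D) g x.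
Proof.
move=> f0 fg; rewrite !ge0_integralE//; last first.
  by move=> x Dx; exact: le_trans (f0 _ Dx) (fg _ Dx).
apply: ge_ereal_sup => _ [h hf <-]; apply: ereal_sup_ubound; exists h => // x.
exact: le_trans (hf x) (lee_restrict fg x).
Qed.

Section boxes.
Context {R : realType}.
Local Notation T := (measurableTypeR R).

Definition box n (a : 'I_n -> R) (l : R) : set (Rn R n) :=
  [set x | forall i, (a i <= Defs.coord x i <= a i + l)%R].

Lemma measurable_borel_box n (a : 'I_n -> R) (l : R) :
  measurable (box a l : set (n.-tuple T)).
Proof.
rewrite (_ : box a l = \bigcap_(i in [set: 'I_n])
  ((fun x : n.-tuple T => tnth x i) @^-1` `[a i, (a i + l)%R])).
  apply: fin_bigcap_measurable => // i _.
  by rewrite -[X in measurable X]setTI; exact: measurable_tnth.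
apply/seteqP; split=> [x bx i _|x bx i]; rewrite /= ?in_itv/=; first exact: bx.
by have := bx i Logic.I; rewrite /= in_itv.
Qed.

Lemma measurable_box n (a : 'I_n -> R) (l : R) : measurable (box a l).
Proof.
apply: (@caratheodory_measurable_mu_ext _ _ _ (@borel_lebesgue R n)).
exact: measurable_borel_box.
Qed.

Lemma borel_lebesgue_box n (a : 'I_n -> R) (l : R) : (0 <= l)%R ->
  @borel_lebesgue R n (box a l) = (l ^+ n)%:E.
Proof.
move=> l0; elim: n a => [|n IH] a.
  by rewrite /= diracE mem_set//= => -[].
rewrite /= /pushforward.
rewrite (_ : _ @^-1` _ = `[a ord0, (a ord0 + l)%R] `*`
   (box (fun i => a (lift ord0 i)) l : set (n.-tuple T))); last first.
  apply/seteqP; split=> [[y x]|[y x]].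
    move=> bx; split=> /=; last first.
      by move=> i; have := bx (lift ord0 i); rewrite /Defs.coord /cons_pair/= tnthS.
    by have := bx ord0; rewrite /Defs.coord /cons_pair/= tnth0 in_itv.
  move=> [/=]; rewrite in_itv/= => yx bx i.
  rewrite /Defs.coord; case: (unliftP ord0 i) => [j ->|->].
    by rewrite tnthS; exact: bx.
  by rewrite tnth0.
rewrite product_measure1E//=; last exact: measurable_borel_box.
rewrite [X in _ * X]IH lebesgue_measure_itv/= lte_fin ltrDl.
case: ifPn => [l1|]; last first.
  rewrite -leNgt => l1; have -> : l = 0%R by apply/eqP; rewrite eq_le l0 l1.
  by rewrite mul0e expr0n.
by rewrite -EFinB addrAC subrr add0r -EFinM exprS.
Qed.

Lemma lebesgue_Rn_box n (a : 'I_n -> R) (l : R) : (0 <= l)%R ->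
  @lebesgue_Rn R n (box a l) = (l ^+ n)%:E.
Proof.
move=> l0; rewrite -(borel_lebesgue_box a l0).
exact: (@measurable_mu_extE _ _ _ (@borel_lebesgue R n) _
  (measurable_borel_box a l)).
Qed.

End boxes.

(** * Vitali covering by cubes *)

Section covering.
Context {R : realType} {n : nat}.
Local Notation mu := (@lebesgue_Rn R n).

Lemma box_neq0 (a : 'I_n -> R) (l : R) : (0 <= l)%R -> box a l !=set0.
Proof.
move=> l0; exists ([tuple a i | i < n] : n.-tuple (measurableTypeR R)) => i.
by rewrite /Defs.coord tnth_mktuple lexx/= lerDl.
Qed.

Lemma box_meet_sub (a b : 'I_n -> R) (l m : R) : (m <= l)%R ->
  box b m `&` box a l !=set0 -> box b m `<=` box (fun i => a i - l)%R (3 * l)%R.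
Proof.
move=> ml [z [bz az]] y byy i.
have := byy i; have := bz i; have := az i; lra.
Qed.

Lemma seq_max_exists (I : eqType) (l : I -> R) (s : seq I) : s != [::] ->
  exists2 i, i \in s & forall j, j \in s -> (l j <= l i)%R.
Proof.
elim: s => // i [_ _|j t /(_ isT)[k kt kmax] _].
  by exists i; rewrite ?mem_head// => j; rewrite inE => /eqP->.
have [lki|lik] := leP (l k) (l i).
  exists i; first exact: mem_head.
  by move=> m; rewrite inE => /predU1P[->//|/kmax/le_trans]; exact.
exists k; first by rewrite inE kt orbT.
by move=> m; rewrite inE => /predU1P[->|/kmax//]; exact: ltW.
Qed.

(* The largest box, tripled, covers every box it meets; the remaining ones are
   disjoint from it, so that the integrals of g add up. *)
Lemma vitali_boxes_finite (I : choiceType) (a : I -> 'I_n -> R) (l : I -> R)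
    (g : Rn R n -> \bar R) (s : seq I) :
    measurable_fun setT g -> (forall x, 0 <= g x) ->
    (forall i, i \in s -> (0 <= l i)%R /\
       (l i ^+ n)%:E <= \int[mu]_(x in box (a i) (l i)) g x) ->
  mu (\big[setU/set0]_(i <- s) box (a i) (l i)) <=
    (3 ^+ n)%:E * \int[mu]_(x in \big[setU/set0]_(i <- s) box (a i) (l i)) g x.
Proof.
move=> mg g0; have [m] := ubnP (size s); elim: m s => // m IH s sm bs.
have [->|s0] := eqVneq s [::].
  by rewrite big_nil measure0 mule_ge0// integral_ge0.
have [i0 i0s i0max] := seq_max_exists l s0.
pose P j := box (a j) (l j) `&` box (a i0) (l i0) == set0.
pose U t := \big[setU/set0]_(i <- t) box (a i) (l i).
have mU t : measurable (U t) by apply: bigsetU_measurable => i _;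
  exact: measurable_box.
(* The filtered list is strictly shorter: [i0] itself fails [P], its box being nonempty. *)
have s'm : (size (seq.filter P s) < m)%N.
  apply: leq_ltn_trans (_ : (size s).-1 < m)%N; last first.
    by rewrite prednK// lt0n size_eq0.
  have : (0 < count (predC P) s)%N.
    rewrite -has_count; apply/hasP; exists i0 => //=.
    by rewrite /P setIid; apply/set0P/box_neq0; case: (bs _ i0s).
  by rewrite size_filter -(count_predC P s) => h; rewrite -ltnS prednK; lia.
have [l0 lg] := bs _ i0s.
have IHs : mu (U (seq.filter P s)) <= (3 ^+ n)%:E * \int[mu]_(x in U (seq.filter
  P s)) g x.
  by apply: IH => // i; rewrite mem_filter => /andP[_ /bs].
have UsE : U (seq.filter P s) `<=` U s.
  move=> x; rewrite /U -!bigcup_seq => -[j /=]; rewrite mem_filter.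
  by move=> /andP[_ js] xj; exists j.
have i0U : box (a i0) (l i0) `<=` U s.
  by move=> x xi; rewrite /U -bigcup_seq; exists i0.
have dis : [disjoint box (a i0) (l i0) & U (seq.filter P s)].
  rewrite disj_set2E; apply/eqP/seteqP; split=> // x [xi].
  rewrite /U -bigcup_seq => -[j /=]; rewrite mem_filter => /andP[/eqP Pj _] xj.
  by have : set0 x by rewrite -Pj.
pose V := box (fun i => a i0 i - l i0)%R (3 * l i0)%R.
have mV : measurable V by exact: measurable_box.
have sub : U s `<=` V `|` U (seq.filter P s).
  move=> x; rewrite /U -bigcup_seq => -[j /= js xj].
  have [Pj|Pj] := boolP (P j).
    by right; rewrite -bigcup_seq; exists j => //=; rewrite mem_filter Pj.
  left; apply: box_meet_sub xj; first exact: i0max.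
  exact/set0P.
apply: (@le_trans _ _ (mu (V `|` U (seq.filter P s)))).
  by apply: le_measure; rewrite ?inE//; [exact: mU|exact: measurableU].
apply: le_trans (measureU2 _ mV (mU _)) _.
rewrite [X in X + _ <= _](_ : _ = ((3 * l i0) ^+ n)%:E); last first.
  by apply: lebesgue_Rn_box; rewrite mulr_ge0.
rewrite exprMn.
apply: (@le_trans _ _ ((3 ^+ n)%:E * (\int[mu]_(x in box (a i0) (l i0)) g x +
   \int[mu]_(x in U (seq.filter P s)) g x))).
  rewrite ge0_muleDr ?integral_ge0//; apply: leeD => //.
  by rewrite EFinM lee_wpmul2l// lee_fin exprn_ge0.
rewrite lee_wpmul2l ?lee_fin ?exprn_ge0//.
have mb : measurable (box (a i0) (l i0)) by exact: measurable_box.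
rewrite -ge0_integral_setU//; last exact: measurable_funTS.
apply: ge0_subset_integral => //; [exact: measurableU|exact: mU| |].
- exact: measurable_funTS.
- by move=> x [/i0U|/UsE].
Qed.

(** The constant 3^n does not depend on the number of boxes, so continuity of [mu] from below, along
    the boxes of index less than m, extends the finite case. *)
Lemma vitali_boxes (a : nat -> 'I_n -> R) (l : nat -> R) (P : pred nat)
    (g : Rn R n -> \bar R) :
    measurable_fun setT g -> (forall x, 0 <= g x) ->
    (forall i, P i -> (0 <= l i)%R /\
       (l i ^+ n)%:E <= \int[mu]_(x in box (a i) (l i)) g x) ->
  mu (\bigcup_(i in [set i | P i]) box (a i) (l i)) <=
    (3 ^+ n)%:E * \int[mu]_x g x.
Proof.
move=> mg g0 bP.
pose U m := \big[setU/set0]_(i <- seq.filter P (iota 0 m)) box (a i) (l i).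
have UE : \bigcup_(i in [set i | P i]) box (a i) (l i) = \bigcup_m U m.
  apply/seteqP; split=> x.
    move=> [i /= Pi xi]; exists i.+1 => //; rewrite /U -bigcup_seq; exists i => //.
    by rewrite /mkset mem_filter Pi mem_iota add0n leqnn.
  move=> [m _]; rewrite /U -bigcup_seq => -[i /=].
  by rewrite mem_filter => /andP[Pi _] xi; exists i.
have mU m : measurable (U m).
  by apply: bigsetU_measurable => i _; exact: measurable_box.
rewrite UE.
have cU : mu (U m) @[m --> \oo] --> mu (\bigcup_m U m).
  apply: nondecreasing_cvg_mu => //; first exact: bigcup_measurable.
  move=> p q pq; apply/subsetPset => x; rewrite /U -!bigcup_seq => -[i /=].
  rewrite mem_filter mem_iota/= add0n => /andP[Pi ip] xi; exists i => //=.
  by rewrite mem_filter mem_iota/= add0n Pi (leq_trans ip).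
rewrite -(cvg_lim _ cU)//; apply: lime_le; first by apply/cvg_ex; eexists;
  exact: cU.
apply: nearW => m.
apply: (@le_trans _ _ ((3 ^+ n)%:E * \int[mu]_(x in U m) g x)).
  apply: vitali_boxes_finite => // i; rewrite mem_filter => /andP[Pi _].
  exact: bP.
rewrite lee_wpmul2l ?lee_fin ?exprn_ge0//; apply: ge0_subset_integral => //.
Qed.

(** Countably many cubes thus suffice to cover a superlevel set. A side above 3l/2 leaves room for a
    corner moved down by less than l/4 in each coordinate; a side below 2l keeps the volume ratio
    below 2^n. *)
Lemma rational_box_cover (a : 'I_n -> R) (l : R) : (0 < l)%R ->
  exists (q : {ffun 'I_n -> rat}) (r : rat),
    (l < ratr r < 2 * l)%R /\
    box a l `<=` box (fun i => ratr (q i)) (ratr r).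
Proof.
move=> l0.
have [r] : exists r : rat, ratr r \in `](3 / 2 * l)%R, (2 * l)%R[.
  by apply: rat_in_itvoo; lra.
rewrite in_itv/= => /andP[r1 r2].
have /choice[q qP] : forall i, exists q : rat, (a i - l / 4 < ratr q < a i)%R.
  move=> i; have [q] : exists q : rat, ratr q \in `](a i - l / 4)%R, (a i)%R[.
    by apply: rat_in_itvoo; lra.
  by rewrite in_itv/= => ?; exists q.
exists [ffun i => q i], r; split; first lra.
move=> x xb i; rewrite ffunE; have := xb i; have := qP i; lra.
Qed.

End covering.

(** * Generalized inverses and Young functions *)

Section generalized_inverse.
Context {R : realType}.
Implicit Types f h : R -> \bar R.

Lemma ginv_ge0 f s : 0 <= ginv f s.
Proof. by apply: le_ereal_inf_tmp => _ [t [t0 _] <-]; rewrite lee_fin. Qed.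

Lemma ginv_le f s t : (0 <= t)%R -> s%:E < f t -> ginv f s <= t%:E.
Proof. by move=> t0 st; apply: ereal_inf_lbound; exists t. Qed.

Lemma ginv_ge f s x : {in Num.nneg &, {homo f : a b / (a <= b)%R >-> a <= b}} ->
  (0 <= x)%R -> f x <= s%:E -> x%:E <= ginv f s.
Proof.
move=> ndf x0 fxs; apply: le_ereal_inf_tmp => _ [t [t0 st] <-].
rewrite lee_fin leNgt; apply/negP => tx.
by have := lt_le_trans st (le_trans (ndf _ _ t0 x0 (ltW tx)) fxs); rewrite ltxx.
Qed.

Lemma ginv_nd f : {homo ginv f : a b / (a <= b)%R >-> a <= b}.
Proof.
move=> s s' ss'; apply: le_ereal_inf => _ [t [t0 st] <-]; exists t => //.
by split=> //; apply: le_lt_trans st; rewrite lee_fin.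
Qed.

Lemma ginv_lt f s y : ginv f s < y ->
  exists t, [/\ (0 <= t)%R, t%:E < y & s%:E < f t].
Proof. by move=> /ereal_inf_lt[_ [t [t0 st] <-] ty]; exists t. Qed.

End generalized_inverse.

Section young_facts.
Context {R : realType}.
Variable A : R -> \bar R.
Hypothesis yA : young_function A.

Lemma young_ge0 t : (0 <= t)%R -> 0 <= A t.
Proof. by move: t; case: yA => -[]. Qed.

Lemma young0 : A 0%R = 0.
Proof. by case: yA => -[]. Qed.

Lemma young_scale k x : (0 <= k <= 1)%R -> (0 <= x)%R ->
  A (k * x)%R <= k%:E * A x.
Proof.
move=> k01 x0; have [_ + _ _] := yA => /(_ k x 0%R k01 x0 (lexx _)).
by rewrite mulr0 addr0 young0 mule0 adde0.
Qed.

Lemma young_nd : {in Num.nneg &, {homo A : a b / (a <= b)%R >-> a <= b}}.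
Proof.
move=> x y; rewrite !nnegrE => x0 y0 xy.
have [y00|yn0] := eqVneq y 0%R.
  by have -> : x = y by apply/eqP; rewrite eq_le xy y00.
have yp : (0 < y)%R by rewrite lt0r yn0.
have -> : x = (x / y * y)%R by rewrite divfK.
have k1 : (0 <= x / y <= 1)%R by rewrite divr_ge0//= ler_pdivrMr// mul1r.
apply: le_trans (young_scale k1 y0) _.
by apply: gee_pMl; rewrite ?young_ge0//; case/andP: k1.
Qed.

Lemma young_expand k x : (1 <= k)%R -> (0 <= x)%R -> k%:E * A x <= A (k * x)%R.
Proof.
move=> k1 x0; have k0 : (0 < k)%R by rewrite (lt_le_trans ltr01).
have := @young_scale (k^-1)%R (k * x)%R.
rewrite mulKf ?gt_eqF// => /(_ _ _)/= H.
rewrite -lee_pdivlMl//; apply: H; last by rewrite mulr_ge0// ltW.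
by rewrite invr_ge0 ltW//= invf_le1.
Qed.

Lemma young_unbounded (M : R) : exists2 x, (0 < x)%R & M%:E < A x.
Proof.
have [x [x0 Ax]] : exists x, (0 < x)%R /\ 0 < A x.
  apply/not_existsP => H; have [_ _ _] := yA; apply; exists 0 => t t0.
  apply/eqP; rewrite eq_le (young_ge0 (ltW t0)) andbT leNgt; apply/negP => At.
  exact: (H t).
have [M0|M0] := ltP M 0%R.
  by exists x => //; apply: lt_trans Ax; rewrite lte_fin.
have [r [r0 rA]] : exists r : R, (0 < r)%R /\ r%:E <= A x.
  move: Ax; case: (A x) => [r| |//] r0; first by exists r; rewrite -lte_fin.
  by exists 1%R; rewrite leey.
pose k := (M / r + 1)%R.
have k1 : (1 <= k)%R by rewrite lerDr divr_ge0// ltW.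
exists (k * x)%R; first by rewrite mulr_gt0// (lt_le_trans ltr01).
apply: lt_le_trans (young_expand k1 (ltW x0)).
apply: (@lt_le_trans _ _ (k%:E * r%:E)).
  by rewrite -EFinM lte_fin mulrDl divfK ?gt_eqF// mul1r ltrDl.
by rewrite lee_wpmul2l// lee_fin (le_trans ler01).
Qed.

Lemma young_finite_point : exists2 x, (0 < x)%R & A x < +oo.
Proof.
apply: contrapT => H; have [_ _ _] := yA; apply; exists +oo => t t0.
apply/eqP; rewrite -leye_eq leNgt; apply/negP => At.
by apply: H; exists t.
Qed.

End young_facts.

(** Superlevel sets of a monotone function are intervals. Values at nonpositive arguments are
    arbitrary, hence the restriction to the positive half-line. *)
Lemma emeasurable_nd_itv (R : realType) (f : R -> \bar R) :
    (forall x y, (0 < x)%R -> (x <= y)%R -> f x <= f y) ->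
  measurable_fun (`]0%R, +oo[ : set (measurableTypeR R)) f.
Proof.
move=> ndf mD; apply: (measurability _ (ErealGenOInfty.measurableE R)) => //.
move=> _ [_ [r ->] <-]; apply: is_interval_measurable => x y/=.
rewrite !in_itv/= !andbT => -[x0 fx] [y0 fy] z /andP[xz zy].
have z0 := lt_le_trans x0 xz.
by rewrite /= !in_itv/= !andbT; split=> //; exact: lt_le_trans fx (ndf _ _ x0 xz).
Qed.

(** * Young functions as primitives of nondecreasing densities *)

Section young_of_density.
Context {R : realType}.
Variable g : R -> R.
Hypothesis g_gt0 : forall x, (0 < x)%R -> (0 < g x)%R.
Hypothesis g_nd : forall x y, (0 < x)%R -> (x <= y)%R -> (g x <= g y)%R.
Local Notation leb := (@lebesgue_measure R).

Definition primitive (t : R) : \bar R := \int[leb]_(s in `]0%R, t[) (g s)%:E.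
Local Notation D := primitive.

Let mg : measurable_fun (`]0%R, +oo[ : set (measurableTypeR R)) (EFin \o g).
Proof. by apply: emeasurable_nd_itv => x y x0 xy; rewrite lee_fin g_nd. Qed.

Let mgS (E : set (measurableTypeR R)) :
  E `<=` `]0%R, +oo[ -> measurable_fun E (EFin \o g).
Proof. by move=> E0; apply: measurable_funS mg. Qed.

Let itv_measure (b1 b2 : bool) (x y : R) : (x <= y)%R ->
  leb [set` Interval (BSide b1 x) (BSide b2 y)] = (y - x)%:E.
Proof.
move=> xy; rewrite lebesgue_measure_itv/= lte_fin.
by case: ltgtP xy => // -> _; rewrite subrr.
Qed.

Lemma primitive_le t : (0 <= t)%R -> D t <= (t * g t)%:E.
Proof.
move=> t0; apply: (@le_trans _ _ (\int[leb]_(s in `]0%R, t[) (cst (g t)%:E) s)).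
  apply: ge0_le_lower_integral => x /=; rewrite in_itv/= => /andP[x0 xt].
    by rewrite lee_fin ltW// g_gt0.
  by rewrite lee_fin g_nd// ltW.
by rewrite integral_cst//= itv_measure// subr0 muleC.
Qed.

Lemma primitive_ge0 t : 0 <= D t.
Proof.
apply: integral_ge0 => x /=; rewrite in_itv/= => /andP[x0 _].
by rewrite lee_fin ltW// g_gt0.
Qed.

Lemma primitive_fin t : (0 <= t)%R -> D t \is a fin_num.
Proof.
move=> t0; rewrite ge0_fin_numE ?primitive_ge0//.
exact: le_lt_trans (primitive_le t0) (ltry _).
Qed.

Lemma primitive_split x y : (0 < x)%R -> (x <= y)%R ->
  D y = D x + \int[leb]_(s in `[x, y[) (g s)%:E.
Proof.
move=> x0 xy; rewrite /D -ge0_integral_setU//=.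
- congr integral; apply/seteqP; split=> s /=; rewrite !in_itv/=.
    by move=> /andP[-> ->]; rewrite andbT; case: ltP; [left|right].
  by move=> []/andP[]; lra.
- apply: mgS => s /= []; rewrite !in_itv/=; lra.
- by move=> s /= []; rewrite !in_itv/= => /andP[s0 _];
  rewrite lee_fin ltW// g_gt0//;
    lra.
- rewrite disj_set2E; apply/eqP/seteqP; split=> // s /= []; rewrite !in_itv/=; lra.
Qed.

(** The line of slope [g z] through (z, D z) lies below D. Convexity, left continuity, nonconstancy
    and the lower bound at 2 y are all read off from it. *)
Lemma primitive_support z y : (0 < z)%R -> (0 <= y)%R ->
  D z + (g z * (y - z))%:E <= D y.
Proof.
move=> z0 y0; have [zy|yz] := leP z y.
  rewrite (primitive_split z0 zy) leeD2l//.
  rewrite EFinM -(itv_measure true true zy) -integral_cst//.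
  apply: ge0_le_lower_integral => s /=; rewrite in_itv/= => /andP[zs _].
    by rewrite lee_fin ltW// g_gt0.
  by rewrite lee_fin g_nd.
have [->|yn0] := eqVneq y 0%R.
  rewrite sub0r mulrN EFinN.
  rewrite leeBlDr//; apply: le_trans (primitive_le (ltW z0)) _.
  by rewrite mulrC leeDr// primitive_ge0.
have yp : (0 < y)%R by rewrite lt0r yn0.
rewrite (primitive_split yp (ltW yz)) -addeA -[leRHS]adde0 leeD2l//.
rewrite -(opprB z) mulrN EFinN leeBlDr// add0e.
rewrite EFinM -(itv_measure true true (ltW yz)) -integral_cst//.
apply: ge0_le_lower_integral => s /=; rewrite in_itv/= => /andP[ys sz].
  by rewrite lee_fin ltW// g_gt0// (lt_le_trans yp).
by rewrite lee_fin g_nd ?(ltW sz)// (lt_le_trans yp).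
Qed.

Lemma primitive_nd : {in Num.nneg &, {homo D : a b / (a <= b)%R >-> a <= b}}.
Proof.
move=> x y; rewrite !nnegrE => x0 y0 xy.
have [->|xn0] := eqVneq x 0%R;
  first by rewrite /D set_itvoo0// integral_set0 primitive_ge0.
have xp : (0 < x)%R by rewrite lt0r xn0.
rewrite (primitive_split xp xy) leeDl//; apply: integral_ge0 => s /=.
by rewrite in_itv/= => /andP[xs _]; rewrite lee_fin ltW// g_gt0// (lt_le_trans xp).
Qed.

Lemma primitive_ge y : (0 < y)%R -> (y * g y)%:E <= D (2 * y)%R.
Proof.
move=> y0; apply: le_trans (primitive_support y0 _); last by rewrite mulr_ge0// ltW.
have -> : (2 * y - y = y)%R by ring.
by rewrite mulrC leeDr// primitive_ge0.
Qed.

Lemma primitive_young : young_function D.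
Proof.
have D0 : D 0%R = 0 by rewrite /D set_itvoo0// integral_set0.
split.
- by split=> // t _; exact: primitive_ge0.
- move=> p x y /andP[p0 p1] x0 y0.
  (* Both support inequalities are taken at the mean z, where the linear terms cancel in the
     weighted sum. *)
  set z := (p * x + (1 - p) * y)%R.
  have z0 : (0 <= z)%R by rewrite addr_ge0 ?mulr_ge0 ?subr_ge0.
  have [->|zn0] := eqVneq z 0%R.
    by rewrite D0 adde_ge0// mule_ge0 ?primitive_ge0// lee_fin ?subr_ge0.
  have zp : (0 < z)%R by rewrite lt0r zn0.
  have := primitive_support zp x0; have := primitive_support zp y0.
  have := fineK (primitive_fin x0); have := fineK (primitive_fin y0).
  have := fineK (primitive_fin z0).
  move: (fine (D x)) (fine (D y)) (fine (D z)) => dx dy dz <- <- <-.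
  rewrite -!EFinM -!EFinD !lee_fin => hy hx.
  have q0 : (0 <= 1 - p)%R by rewrite subr_ge0.
  apply: le_trans (lerD (ler_wpM2l p0 hx) (ler_wpM2l q0 hy)).
  by rewrite le_eqVlt; apply/orP; left; apply/eqP; rewrite /z; ring.
- move=> t t0; rewrite -(fineK (primitive_fin (ltW t0))); apply/fine_cvgP; split.
    near=> x; apply: primitive_fin; near: x.
    by apply: nbhs_left_ge.
  (* To the left of t, D lies between its support line at t and its value at t. *)
  apply: (@squeeze_cvgr _ _ _ _ (fun x => fine (D t) - g t * (t - x))%R
     (fun=> fine (D t))).
  + near=> x; have x0 : (0 <= x)%R by near: x; apply: nbhs_left_ge.
    have xt : (x <= t)%R by near: x; apply: nbhs_left_le.
    have := primitive_support t0 x0.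
    have : D x <= D t by apply: primitive_nd; rewrite ?nnegrE// ltW.
    have := fineK (primitive_fin x0); have := fineK (primitive_fin (ltW t0)).
    rewrite /=; move: (fine (D x)) (fine (D t)) => dx dt <- <-.
    rewrite -!EFinD !lee_fin; lra.
  + have h : (fun x => fine (D t) - g t * (t - x))%R x @[x --> t] -->
        (fine (D t) - g t * (t - t))%R.
      by apply: cvgB; [exact: cvg_cst|apply: cvgM; [exact: cvg_cst|apply: cvgB;
        [exact: cvg_cst|exact: cvg_id]]].
    move: h; rewrite subrr mulr0 subr0 => h.
    exact: cvg_at_left_filter.
  + exact: cvg_cst.
- move=> [c Dc].
  have c0 : 0 <= c by rewrite -(Dc _ ltr01) primitive_ge0.
  have cfin : c \is a fin_num by rewrite -(Dc _ ltr01) primitive_fin.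
  (* A constant value c would satisfy c + g 1 <= c. *)
  have := primitive_support (@ltr01 R) (@ler0n R 2).
  rewrite !Dc//; move: c0 cfin; case: c {Dc} => // c _ _.
  rewrite -EFinD lee_fin; have := g_gt0 (@ltr01 R); lra.
Unshelve. all: by end_near. Qed.

End young_of_density.

(** * The functions F and E *)

Section exponents.
Context {R : realType} (n : nat) (gamma : R).
Hypotheses (gamma_gt0 : (0 < gamma)%R) (gamma_ltn : (gamma < n%:R)%R).

Lemma dim_gt0 : (0 < n%:R :> R)%R. Proof. exact: lt_trans gamma_ltn. Qed.

Lemma crit_exp_gt1 : (1 < crit_exp n gamma)%R.
Proof.
rewrite /crit_exp ltr_pdivlMr ?subr_gt0// mul1r.
by rewrite ltrBlDr ltrDl.
Qed.

Lemma crit_exp_gt0 : (0 < crit_exp n gamma)%R.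
Proof. exact: lt_trans crit_exp_gt1. Qed.

Lemma ratio_gt0 : (0 < gamma / n%:R)%R.
Proof. by rewrite divr_gt0// dim_gt0. Qed.

Lemma ratio_lt1 : (gamma / n%:R < 1)%R.
Proof. by rewrite ltr_pdivrMr ?dim_gt0// mul1r. Qed.

Lemma crit_exp_conj : (1 - gamma / n%:R = (crit_exp n gamma)^-1)%R.
Proof.
have := dim_gt0; rewrite /crit_exp => n0; rewrite invf_div.
by field; rewrite gt_eqF.
Qed.

(** In the form T (T^p)^(gamma/n) = T^p this identity rewrites the truncation level T F(T)^(gamma/n)
    as T^p W(T)^(gamma/n). *)
Lemma crit_exp_ratio : (1 + crit_exp n gamma * (gamma / n%:R) = crit_exp n gamma)%R.
Proof.
have -> : (gamma / n%:R = 1 - (crit_exp n gamma)^-1)%R.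
  by rewrite -crit_exp_conj subKr.
by rewrite mulrBr mulr1 mulfV ?gt_eqF ?crit_exp_gt0// subrKC.
Qed.

End exponents.

Section weighted.
Context {R : realType} (n : nat) (gamma : R) (B : R -> \bar R).
Hypotheses (gamma_gt0 : (0 < gamma)%R) (gamma_ltn : (gamma < n%:R)%R).
Hypothesis yB : young_function B.
Local Notation leb := (@lebesgue_measure R).
Local Notation p := (crit_exp n gamma).
Local Notation W := (weighted_integral n gamma B).
Local Notation F := (F_fun n gamma B).
Local Notation w := (fun s => B s / (s `^ (p + 1))%:E).

Let p1 : (1 < p)%R. Proof. exact: crit_exp_gt1. Qed.
Let p0 : (0 < p)%R. Proof. exact: crit_exp_gt0. Qed.

Lemma weight_ge0 s : (0 < s)%R -> 0 <= w s.
Proof.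
move=> s0; apply: mule_ge0; first exact/(young_ge0 yB)/ltW.
by rewrite inve_ge0 lee_fin powR_ge0.
Qed.

Lemma measurable_weight :
  measurable_fun (`]0%R, +oo[ : set (measurableTypeR R)) w.
Proof.
apply: emeasurable_funM.
  by apply: emeasurable_nd_itv => x y x0 xy; apply: (young_nd yB) => //;
    rewrite nnegrE ltW// (lt_le_trans x0).
apply: (eq_measurable_fun (fun s : R => (s `^ (- (p + 1)))%:E)).
  move=> s; rewrite inE/= in_itv/= andbT => s0.
  by rewrite inver gt_eqF ?powR_gt0// powRN.
apply/measurable_EFinP; apply: measurable_funTS; exact: measurable_powR.
Qed.

Lemma weighted_integral_split x y : (0 < x)%R -> (x <= y)%R ->
  W y = W x + \int[leb]_(s in `[x, y[) w s.
Proof.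
move=> x0 xy; rewrite /weighted_integral -ge0_integral_setU//=.
- congr integral; apply/seteqP; split=> s /=; rewrite !in_itv/=.
    by move=> /andP[-> ->]; rewrite andbT; case: ltP; [left|right].
  by move=> []/andP[]; lra.
- apply: measurable_funS measurable_weight => // s /= []; rewrite !in_itv/=; lra.
- by move=> s /= []; rewrite !in_itv/= => /andP[s0 _]; apply: weight_ge0; lra.
- rewrite disj_set2E; apply/eqP/seteqP; split=> // s /= []; rewrite !in_itv/=; lra.
Qed.

Lemma weighted_slice_ge x y : (0 < x)%R -> (x <= y)%R ->
  B x * ((y - x) / y `^ (p + 1))%:E <= \int[leb]_(s in `[x, y[) w s.
Proof.
move=> x0 xy; have y0 := lt_le_trans x0 xy.
apply: (@le_trans _ _
   (\int[leb]_(s in `[x, y[) (cst (B x * (y `^ (p + 1))^-1%:E) s))).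
  rewrite integral_cst//= [leb _]lebesgue_measure_itv/= lte_fin.
  rewrite -muleA; apply: lee_wpmul2l; first exact/(young_ge0 yB)/ltW.
  case: ltgtP xy => // [_ _|-> _]; last by rewrite subrr mul0r mule0.
  by rewrite -EFinB -EFinM mulrC.
apply: ge0_le_lower_integral => s /=; rewrite in_itv/= => /andP[xs sy].
  by apply: mule_ge0; [exact/(young_ge0 yB)/ltW|rewrite lee_fin invr_ge0 powR_ge0].
have s0 := lt_le_trans x0 xs.
rewrite inver gt_eqF ?powR_gt0//; apply: lee_pmul.
- exact/(young_ge0 yB)/ltW.
- by rewrite lee_fin invr_ge0 powR_ge0.
- by apply: (young_nd yB); rewrite ?nnegrE// ltW.
- rewrite lee_fin lef_pV2 ?posrE ?powR_gt0//.
  by rewrite ge0_ler_powR ?nnegrE// ?addr_ge0 ?(ltW p0) ?ltW.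
Qed.

Lemma weighted_slice_le x y : (0 < x)%R -> (x <= y)%R ->
  \int[leb]_(s in `[x, y[) w s <= B y * ((y - x) / x `^ (p + 1))%:E.
Proof.
move=> x0 xy; have y0 := lt_le_trans x0 xy.
apply: (@le_trans _ _
   (\int[leb]_(s in `[x, y[) (cst (B y * (x `^ (p + 1))^-1%:E) s))); last first.
  rewrite integral_cst//= [leb _]lebesgue_measure_itv/= lte_fin.
  rewrite -muleA; apply: lee_wpmul2l; first exact/(young_ge0 yB)/ltW.
  case: ltgtP xy => // [_ _|-> _]; last by rewrite subrr mul0r mule0.
  by rewrite -EFinB -EFinM mulrC.
apply: ge0_le_lower_integral => s /=; rewrite in_itv/= => /andP[xs sy].
  exact/weight_ge0/(lt_le_trans x0).
have s0 := lt_le_trans x0 xs.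
rewrite inver gt_eqF ?powR_gt0//; apply: lee_pmul.
- exact/(young_ge0 yB)/ltW.
- by rewrite lee_fin invr_ge0 powR_ge0.
- by apply: (young_nd yB); rewrite ?nnegrE// ltW.
- rewrite lee_fin lef_pV2 ?posrE ?powR_gt0//.
  by rewrite ge0_ler_powR ?nnegrE// ?addr_ge0 ?(ltW p0) ?ltW.
Qed.

Lemma weighted_integral0 : W 0%R = 0.
Proof. by rewrite /weighted_integral set_itvoo0// integral_set0. Qed.

Lemma weighted_integral_ge0 t : 0 <= W t.
Proof. by apply: integral_ge0 => s /=; rewrite in_itv/= => /andP[/weight_ge0]. Qed.

Lemma weighted_integral_nd : {in Num.nneg &, {homo W : a b / (a <= b)%R >-> a <=
  b}}.
Proof.
move=> x y; rewrite !nnegrE => x0 y0 xy.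
have [->|xn0] := eqVneq x 0%R;
  first by rewrite weighted_integral0 weighted_integral_ge0.
have xp : (0 < x)%R by rewrite lt0r xn0.
rewrite (weighted_integral_split xp xy) leeDl//; apply: integral_ge0 => s /=.
by rewrite in_itv/= => /andP[xs _]; apply/weight_ge0/(lt_le_trans xp).
Qed.

Lemma F_fun0 : F 0%R = 0.
Proof. by rewrite /F_fun weighted_integral0 mule0. Qed.

Lemma F_fun_ge0 t : 0 <= F t.
Proof. by rewrite /F_fun mule_ge0 ?weighted_integral_ge0// lee_fin powR_ge0. Qed.

Lemma F_fun_scale_powR k t : (1 <= k)%R -> (0 <= t)%R ->
  (k `^ p)%:E * F t <= F (k * t)%R.
Proof.
move=> k1 t0; have k0 : (0 <= k)%R by rewrite (le_trans ler01).
rewrite /F_fun powRM// EFinM -muleA; apply: lee_wpmul2l.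
  by rewrite lee_fin powR_ge0.
apply: lee_wpmul2l; first by rewrite lee_fin powR_ge0.
by apply: weighted_integral_nd; rewrite ?nnegrE ?mulr_ge0// ler_peMl.
Qed.

Lemma F_fun_scale k t : (1 <= k)%R -> (0 <= t)%R -> k%:E * F t <= F (k * t)%R.
Proof.
move=> k1 t0; apply: le_trans (F_fun_scale_powR k1 t0).
rewrite lee_wpmul2r ?F_fun_ge0// lee_fin.
by rewrite -[leLHS]powRr1 ?(le_trans ler01)// ler_powR// ltW.
Qed.

Lemma F_fun_nd : {in Num.nneg &, {homo F : a b / (a <= b)%R >-> a <= b}}.
Proof.
move=> x y; rewrite !nnegrE => x0 y0 xy; apply: lee_pmul.
- by rewrite lee_fin powR_ge0.
- exact: weighted_integral_ge0.
- by rewrite lee_fin ge0_ler_powR ?nnegrE// ltW.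
- by apply: weighted_integral_nd; rewrite ?nnegrE.
Qed.

Lemma young_le_weighted_increment x : (0 < x)%R ->
  B x * (2 `^ (- (p + 1)) * x `^ (- p))%:E + W x <= W (2 * x)%R.
Proof.
move=> x0; have x2 : (x <= 2 * x)%R by lra.
rewrite (weighted_integral_split x0 x2) addeC leeD2l//.
apply: le_trans (weighted_slice_ge x0 x2).
have -> : (2 * x - x = x)%R by ring.
rewrite powRM//; last exact: ltW.
rewrite invfM -!powRN mulrCA -[X in (_ * (X * _))%R](powRr1 (ltW x0)).
rewrite -powRD; last by rewrite (gt_eqF x0) implybT.
by rewrite (_ : (1 - (p + 1) = - p)%R)//; ring.
Qed.

(** One factor 2 is the interval [x, 2x[, whose contribution to W already gives F(2x) >= B(x)/2; the
    other doubles F and removes the 1/2. *)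
Lemma young_le_F_fun x : (0 <= x)%R -> B x <= F (4 * x)%R.
Proof.
rewrite le_eqVlt => /predU1P[<-|x0]; first by rewrite mulr0 F_fun0 (young0 yB).
have -> : (4 * x = 2 * (2 * x))%R by ring.
apply: le_trans (F_fun_scale _ _); rewrite ?mulr_ge0 ?(ltW x0) ?ler1n//.
rewrite -lee_pdivrMl// muleC.
apply: (@le_trans _ _ (((2 * x) `^ p)%:E *
    (B x * (2 `^ (- (p + 1)) * x `^ (- p))%:E + W x))); last first.
  by apply: lee_wpmul2l;
    [rewrite lee_fin powR_ge0|exact: young_le_weighted_increment].
apply: (@le_trans _ _ (((2 * x) `^ p)%:E *
    (B x * (2 `^ (- (p + 1)) * x `^ (- p))%:E))); last first.
  by apply: lee_wpmul2l;
    [rewrite lee_fin powR_ge0|rewrite leeDl// weighted_integral_ge0].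
rewrite muleCA -EFinM lee_wpmul2l//; first exact/(young_ge0 yB)/ltW.
rewrite lee_fin powRM ?(ltW x0)// mulrACA -!powRD; last 2 first.
  by rewrite (gt_eqF x0) implybT.
  by rewrite pnatr_eq0 implybT.
by rewrite opprD addrA subrr add0r powRr0 mulr1 powR_inv1.
Qed.

Lemma F_fun_unbounded (M : R) : exists2 x, (0 < x)%R & M%:E < F x.
Proof.
have [x x0 Mx] := young_unbounded yB M.
exists (4 * x)%R; first by rewrite mulr_gt0.
exact: lt_le_trans Mx (young_le_F_fun (ltW x0)).
Qed.

Lemma F_fun_lty_converges t : (0 < t)%R -> F t < +oo -> converges_at_0 n gamma B.
Proof.
move=> t0 Ft; exists t => //; rewrite ltNge leye_eq; apply/negP => /eqP Wt.
by move: Ft; rewrite /F_fun Wt gt0_muley ?ltxx// lte_fin powR_gt0.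
Qed.

End weighted.

(** * The optimal Young function *)

Section optimal.
Context {R : realType} (n : nat) (gamma : R) (B : R -> \bar R).
Hypotheses (gamma_gt0 : (0 < gamma)%R) (gamma_ltn : (gamma < n%:R)%R).
Hypothesis yB : young_function B.
Hypothesis convB : converges_at_0 n gamma B.
Local Notation p := (crit_exp n gamma).
Local Notation al := (gamma / n%:R)%R.
Local Notation W := (weighted_integral n gamma B).
Local Notation F := (F_fun n gamma B).
Local Notation E := (E_fun n gamma B).
Local Notation D := (optimal_young n gamma B).

Let p0 : (0 < p)%R. Proof. exact: crit_exp_gt0. Qed.
Let al0 : (0 < al)%R. Proof. exact: ratio_gt0. Qed.

Lemma powR_le_exists (q c e : R) : (0 < q)%R -> (0 < c)%R -> (0 < e)%R ->
  exists2 t, (0 < t)%R & forall s, (0 <= s)%R -> (s <= t)%R -> (s `^ q * c <= e)%R.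
Proof.
move=> q0 c0 e0; exists ((e / c) `^ q^-1)%R; first by rewrite powR_gt0 ?divr_gt0.
move=> s s0 st; rewrite -ler_pdivlMr//.
apply: le_trans (ge0_ler_powR (ltW q0) _ _ st) _; rewrite ?nnegrE ?powR_ge0//.
by rewrite -powRrM mulVf ?gt_eqF// powRr1// divr_ge0 ?ltW.
Qed.

(** Convergence at 0 enters here: near 0 it bounds F by a multiple of t^p, which makes F^-1 and E
    positive at positive arguments. *)
Lemma F_fun_small (e : R) : (0 < e)%R -> exists2 t, (0 < t)%R & F t <= e%:E.
Proof.
move=> e0; have [d d0 Wd] := convB.
have Wfin : W d \is a fin_num by rewrite ge0_fin_numE// (weighted_integral_ge0 _
  _ yB).
have c0 : (0 <= fine (W d))%R by rewrite fine_ge0// (weighted_integral_ge0 _ _ yB).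
(* Adding 1 keeps the coefficient positive even if W d = 0. *)
have [t t0 tP] := @powR_le_exists p (fine (W d) + 1)%R e p0 (ltr_wpDl c0 ltr01) e0.
have m0 : (0 < Num.min t d)%R by rewrite lt_min t0.
exists (Num.min t d) => //.
apply: (@le_trans _ _ ((Num.min t d `^ p)%:E * (fine (W d) + 1)%:E)); last first.
  by rewrite -EFinM lee_fin tP ?(ltW m0)// ge_min lexx.
apply: lee_wpmul2l; first by rewrite lee_fin powR_ge0.
apply: (@le_trans _ _ (W d)).
  by apply: (weighted_integral_nd _ _ yB);
    rewrite ?nnegrE ?(ltW m0) ?(ltW d0)// ge_min lexx orbT.
by rewrite -[in leLHS](fineK Wfin) lee_fin lerDl.
Qed.

Lemma ginv_F_fun_fin s : ginv F s \is a fin_num.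
Proof.
have [x x0 sx] := F_fun_unbounded gamma_gt0 gamma_ltn yB s.
rewrite ge0_fin_numE ?ginv_ge0//.
exact: le_lt_trans (ginv_le (ltW x0) sx) (ltry _).
Qed.

Lemma ginv_F_fun_gt0 s : (0 < s)%R -> 0 < ginv F s.
Proof.
move=> /F_fun_small[t t0 Ft].
apply: lt_le_trans (ginv_ge (F_fun_nd gamma_gt0 gamma_ltn yB) (ltW t0) Ft).
by rewrite lte_fin.
Qed.

(** Degree at least p for F becomes degree at most 1/p for its inverse; with the factor t^(gamma/n)
    the degrees in [E] add up to 1. *)
Lemma ginv_F_fun_scale k t : (1 <= k)%R ->
  ginv F (k * t)%R <= (k `^ p^-1)%:E * ginv F t.
Proof.
move=> k1; have k0 : (0 < k)%R := lt_le_trans ltr01 k1.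
have q0 : (0 < k `^ p^-1)%R by rewrite powR_gt0.
rewrite -lee_pdivrMl//; apply: le_ereal_inf_tmp => _ [x [x0 tx] <-].
rewrite lee_pdivrMl// -EFinM; apply: ginv_le; first by rewrite mulr_ge0// ltW.
apply: lt_le_trans (F_fun_scale_powR _ _ yB _ x0); last first.
  have : (1 `^ p^-1 <= k `^ p^-1)%R 
    by rewrite ge0_ler_powR ?nnegrE ?invr_ge0 ?(ltW p0) ?(ltW k0).
  by rewrite powR1.
rewrite -powRrM mulVf ?gt_eqF// powRr1; last exact: ltW.
by rewrite EFinM lte_pmul2l.
Qed.

Lemma E_fun_fin t : E t \is a fin_num.
Proof. by rewrite /E_fun fin_numM// ginv_F_fun_fin. Qed.

Lemma E_fun_gt0 t : (0 < t)%R -> 0 < E t.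
Proof. by move=> t0; rewrite /E_fun mule_gt0 ?ginv_F_fun_gt0// lte_fin powR_gt0.
  Qed.

Lemma E_fun_nd : {in Num.nneg &, {homo E : a b / (a <= b)%R >-> a <= b}}.
Proof.
move=> x y; rewrite !nnegrE => x0 y0 xy; apply: lee_pmul.
- by rewrite lee_fin powR_ge0.
- exact: ginv_ge0.
- by rewrite lee_fin ge0_ler_powR ?nnegrE// ltW.
- exact: ginv_nd.
Qed.

Lemma E_fun_scale k t : (1 <= k)%R -> (0 <= t)%R -> E (k * t)%R <= k%:E * E t.
Proof.
move=> k1 t0; have k0 : (0 < k)%R := lt_le_trans ltr01 k1.
rewrite /E_fun powRM//; last exact: ltW.
apply: (@le_trans _ _ ((k `^ al * t `^ al)%:E * ((k `^ p^-1)%:E * ginv F t))).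
  by rewrite lee_wpmul2l ?ginv_F_fun_scale// lee_fin mulr_ge0// powR_ge0.
rewrite muleA -EFinM mulrAC -powRD; last by rewrite (gt_eqF k0) implybT.
rewrite -(crit_exp_conj gamma_gt0 gamma_ltn) subrKC powRr1; last exact: ltW.
by rewrite EFinM muleA.
Qed.

Let c1 := fine (ginv F 1).
Let c1E : ginv F 1%R = c1%:E. Proof. by rewrite fineK// ginv_F_fun_fin. Qed.
Let c1_gt0 : (0 < c1)%R. Proof. by rewrite -lte_fin -c1E ginv_F_fun_gt0. Qed.

Lemma E_fun_small (e : R) : (0 < e)%R -> exists2 t, (0 < t)%R & E t <= e%:E.
Proof.
move=> e0; have [t t0 tP] := powR_le_exists al0 c1_gt0 e0.
have m0 : (0 < Num.min t 1)%R by rewrite lt_min t0 ltr01.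
exists (Num.min t 1%R) => //.
apply: (@le_trans _ _ ((Num.min t 1 `^ al)%:E * ginv F 1%R)).
  apply: lee_wpmul2l; first by rewrite lee_fin powR_ge0.
  by apply: ginv_nd; rewrite ge_min lexx orbT.
by rewrite c1E -EFinM lee_fin tP ?(ltW m0)// ge_min lexx.
Qed.

Lemma E_fun_unbounded (M : R) : exists2 t, (0 < t)%R & M%:E < E t.
Proof.
(* For t >= 1 one has E t >= t^(gamma/n) c1; the choice of [N] and t makes this at least |M| + 1. *)
pose N := ((`|M| + 1) / c1)%R.
have N0 : (0 < N)%R by rewrite divr_gt0// ltr_wpDl.
pose t := Num.max 1%R (N `^ al^-1)%R.
have t1 : (1 <= t)%R by rewrite le_max lexx.
exists t; first exact: lt_le_trans t1.
apply: (@lt_le_trans _ _ (N * c1)%:E).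
  by rewrite lte_fin divfK ?gt_eqF// (le_lt_trans (ler_norm _))// ltrDl.
rewrite EFinM -c1E; apply: lee_pmul.
- by rewrite lee_fin ltW.
- exact: ginv_ge0.
- have NE : N = ((N `^ al^-1) `^ al)%R.
    by rewrite -powRrM mulVf ?gt_eqF// powRr1// ltW.
  rewrite lee_fin [leLHS]NE ge0_ler_powR ?nnegrE ?powR_ge0 ?(ltW al0)//.
    exact: le_trans t1.
  by rewrite le_max lexx orbT.
- exact: ginv_nd.
Qed.

Lemma ginv_E_fun_fin s : ginv E s \is a fin_num.
Proof.
have [x x0 sx] := E_fun_unbounded s.
rewrite ge0_fin_numE ?ginv_ge0//.
exact: le_lt_trans (ginv_le (ltW x0) sx) (ltry _).
Qed.

Lemma ginv_E_fun_gt0 s : (0 < s)%R -> 0 < ginv E s.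
Proof.
move=> /E_fun_small[t t0 Et]; apply: lt_le_trans (ginv_ge E_fun_nd (ltW t0) Et).
by rewrite lte_fin.
Qed.

Lemma ginv_E_fun_scale k s : (1 <= k)%R -> k%:E * ginv E s <= ginv E (k * s)%R.
Proof.
move=> k1; have k0 : (0 < k)%R := lt_le_trans ltr01 k1.
apply: le_ereal_inf_tmp => _ [x [x0 sx] <-].
rewrite -lee_pdivlMl// -EFinM; apply: ginv_le.
  by rewrite mulr_ge0// invr_ge0 ltW.
rewrite -(@lte_pmul2l _ k%:E)// -EFinM; apply: lt_le_trans sx _.
by rewrite -{1}(mulVKf (lt0r_neq0 k0) x) E_fun_scale// mulr_ge0// invr_ge0 ltW.
Qed.

Definition optimal_density (s : R) : R := (fine (ginv E s) / s)%R.
Local Notation g := optimal_density.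

Lemma optimal_density_gt0 s : (0 < s)%R -> (0 < g s)%R.
Proof.
by move=> s0; rewrite divr_gt0// fine_gt0// ginv_E_fun_gt0//= ltey_eq
  ginv_E_fun_fin.
Qed.

Lemma optimal_density_nd s t : (0 < s)%R -> (s <= t)%R -> (g s <= g t)%R.
Proof.
move=> s0 st; have t0 := lt_le_trans s0 st.
rewrite /g ler_pdivrMr// mulrAC ler_pdivlMr// -lee_fin !EFinM !fineK
  ?ginv_E_fun_fin//.
have k1 : (1 <= t / s)%R by rewrite ler_pdivlMr// mul1r.
have := ginv_E_fun_scale s k1; rewrite divfK ?gt_eqF// => /(@lee_wpmul2l _ s%:E).
by rewrite muleA -EFinM mulrC divfK ?gt_eqF// muleC (muleC s%:E); apply;
   rewrite lee_fin ltW.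
Qed.

Lemma optimal_youngE : D = primitive g.
Proof.
apply/funext => t; apply: eq_integral => s; rewrite inE/= in_itv/= => /andP[s0 _].
by rewrite inver gt_eqF// /g EFinM fineK ?ginv_E_fun_fin.
Qed.

Lemma optimal_young_young : young_function D.
Proof.
rewrite optimal_youngE; apply: primitive_young.
- exact: optimal_density_gt0.
- exact: optimal_density_nd.
Qed.

Lemma optimal_density_mul y : (0 < y)%R -> (y * g y)%:E = ginv E y.
Proof.
by move=> y0; rewrite mulrC divfK ?gt_eqF// fineK// ginv_E_fun_fin.
Qed.

Lemma optimal_le y : (0 < y)%R -> D y <= ginv E y.
Proof.
move=> y0; rewrite optimal_youngE -optimal_density_mul//; apply: primitive_le.
- exact: optimal_density_gt0.
- exact: optimal_density_nd.
- exact: ltW.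
Qed.

Lemma optimal_ge y : (0 < y)%R -> ginv E y <= D (2 * y)%R.
Proof.
move=> y0; rewrite optimal_youngE -optimal_density_mul//; apply: primitive_ge => //.
- exact: optimal_density_gt0.
- exact: optimal_density_nd.
Qed.

Lemma optimal_at_E t : (0 < t)%R -> t%:E <= D (2 * fine (E t))%R.
Proof.
move=> t0; apply: le_trans (optimal_ge _); last first.
  by rewrite fine_gt0// E_fun_gt0//= ltey_eq E_fun_fin.
apply: ginv_ge; [exact: E_fun_nd|exact: ltW|by rewrite fineK ?E_fun_fin].
Qed.

(** At arguments t < f = F T the inverse of F is at most T, so E t <= z := T f^(gamma/n) there and
    E^-1(z) >= f. The density at z is thus at least f / z = f^(1/p) / T, and it is nondecreasing. As
    f^(1/p) / T = W(T)^(1/p), this is the lower bound for D that the telescoped sum has to meet. *)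
Lemma optimal_ge_at T f y : (0 < T)%R -> (0 < f)%R -> F T = f%:E ->
  (T * f `^ al <= y)%R -> (y * (f `^ p^-1 / T))%:E <= D (2 * y)%R.
Proof.
move=> T0 f0 FT Ty.
have z0 : (0 < T * f `^ al)%R by rewrite mulr_gt0// powR_gt0.
have y0 := lt_le_trans z0 Ty.
apply: le_trans (optimal_ge y0); rewrite -optimal_density_mul// lee_fin.
apply: ler_wpM2l; first exact: ltW.
apply: le_trans (optimal_density_nd z0 Ty).
rewrite -(crit_exp_conj gamma_gt0 gamma_ltn) powRB;
  last by rewrite (gt_eqF f0) implybT.
rewrite powRr1; last exact: ltW.
rewrite /g -mulrA -invfM (mulrC _ T) ler_pM2r ?invr_gt0// -lee_fin fineK
  ?ginv_E_fun_fin//.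
apply: le_ereal_inf_tmp => _ [t [t0 Et] <-]; rewrite lee_fin leNgt;
  apply/negP => tf.
have : E t <= (T * f `^ al)%:E.
  rewrite mulrC EFinM; apply: lee_pmul.
  - by rewrite lee_fin powR_ge0.
  - exact: ginv_ge0.
  - by rewrite lee_fin ge0_ler_powR ?nnegrE// ltW.
  - by apply: ginv_le; [exact: ltW|rewrite FT lte_fin].
by rewrite leNgt Et.
Qed.

Lemma E_le_ginv_optimal t : (0 < t)%R -> E t <= ginv D t.
Proof.
move=> t0; apply: le_ereal_inf_tmp => _ [y [y0 ty] <-].
rewrite leNgt; apply/negP => yE.
have yp : (0 < y)%R.
  rewrite lt0r y0 andbT; apply/eqP => y00; move: ty.
  by rewrite y00 (young0 optimal_young_young) lte_fin ltNge ltW.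
have := lt_le_trans ty (optimal_le yp).
by rewrite ltNge ginv_le// ltW.
Qed.

Lemma ginv_optimal_le_E t : (0 < t)%R -> ginv D t <= 4%:E * E t.
Proof.
move=> t0; rewrite -(fineK (E_fun_fin t)) -EFinM.
have e0 : (0 < fine (E t))%R by rewrite fine_gt0// E_fun_gt0//= ltey_eq E_fun_fin.
apply: ginv_le; first by rewrite mulr_ge0// ltW.
(* [ginv] asks for D to exceed t strictly; a second doubling gives D(4 E t) >= 2 t. *)
have -> : (4 * fine (E t) = 2 * (2 * fine (E t)))%R by ring.
have h2 : (1 <= 2 :> R)%R by rewrite ler1n.
apply: lt_le_trans (young_expand optimal_young_young h2 _); last first.
  by rewrite mulr_ge0// ltW.
apply: (@lt_le_trans _ _ (2%:E * t%:E)); first by rewrite -EFinM lte_fin; lra.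
by rewrite lee_wpmul2l// optimal_at_E.
Qed.

End optimal.

(** * The maximal operator on the optimal space *)

Section young_extended.
Context {R : realType}.
Variable A : R -> \bar R.
Hypothesis yA : young_function A.

Lemma young_ext_ge0 x : 0 <= x -> 0 <= young_ext A x.
Proof. by case: x => [r| |]//=; rewrite ?lee_fin ?leey// => r0;
  exact: young_ge0. Qed.

Lemma young_ext_nd x y : 0 <= x -> x <= y -> young_ext A x <= young_ext A y.
Proof.
case: x => [r| |]//; case: y => [s| |]//=; rewrite ?leey// !lee_fin => r0 rs.
by apply: (young_nd yA); rewrite ?nnegrE// (le_trans r0).
Qed.

End young_extended.

Lemma ge0_integral_le_setT (d : measure_display) (T : measurableType d) (R :
  realType)
    (mu : {measure set T -> \bar R}) (Q : set T) (f : T -> \bar R) :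
  (forall x, 0 <= f x) -> \int[mu]_(x in Q) f x <= \int[mu]_x f x.
Proof.
move=> f0; rewrite integral_mkcond; apply: ge0_le_lower_integral => x _.
  by apply: erestrict_ge0.
by rewrite patchE; case: ifP.
Qed.

(** * Weak-type estimate for the fractional maximal operator *)

Section weak_type.
Context {R : realType} (n : nat) (gamma : R) (B : R -> \bar R).
Hypotheses (gamma_gt0 : (0 < gamma)%R) (gamma_ltn : (gamma < n%:R)%R).
Hypothesis yB : young_function B.
Hypothesis convB : converges_at_0 n gamma B.
Local Notation p := (crit_exp n gamma).
Local Notation al := (gamma / n%:R)%R.
Local Notation F := (F_fun n gamma B).
Local Notation E := (E_fun n gamma B).
Local Notation D := (optimal_young n gamma B).
Local Notation mu := (@lebesgue_Rn R n).

Let al0 : (0 < al)%R. Proof. exact: ratio_gt0. Qed.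
Let al1 : (al < 1)%R. Proof. exact: ratio_lt1. Qed.
Let yD : young_function D. Proof. exact: optimal_young_young. Qed.

Variable f : Rn R n -> \bar R.
Hypothesis mf : measurable_fun setT f.

Definition upper_part (s : R) : Rn R n -> \bar R :=
  (abse \o f) \_ [set x | s%:E < `|f x|].

Let mabsf : measurable_fun setT (abse \o f).
Proof. exact: measurableT_comp. Qed.

Lemma measurable_upper_part s : measurable_fun setT (upper_part s).
Proof.
apply/(measurable_restrictT _ _).1; last exact: measurable_funTS.
rewrite -[X in measurable X]setTI.
exact: emeasurable_fun_o_infty.
Qed.

Lemma upper_part_ge0 s x : 0 <= upper_part s x.
Proof. by apply: erestrict_ge0 => y _; exact: abse_ge0. Qed.

Lemma integral_box_le_upper (a : 'I_n -> R) (l s : R) : (0 <= l)%R -> (0 <= s)%R ->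
  \int[mu]_(x in box a l) `|f x| <=
    (s * l ^+ n)%:E + \int[mu]_(x in box a l) upper_part s x.
Proof.
move=> l0 s0; have mb : measurable (box a l) by exact: measurable_box.
apply: (@le_trans _ _ (\int[mu]_(x in box a l) (cst s%:E x + upper_part s x))).
  apply: ge0_le_lower_integral => x _ //; rewrite /upper_part patchE.
  case: ifPn => [_|]; first by rewrite leeDr// lee_fin.
  by rewrite notin_setE/= adde0 => /negP; rewrite -leNgt.
rewrite ge0_integralD//; last 2 first.
- by move=> x _; exact: upper_part_ge0.
- by apply: measurable_funTS; exact: measurable_upper_part.
rewrite integral_cst// leeD2r// EFinM [X in _ * X <= _](_ : _ = (l ^+ n)%:E)//.
exact: lebesgue_Rn_box.
Qed.

Hypothesis int_f : \int[mu]_x young_ext D `|f x| <= 1.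

(** A Chebyshev bound linear in f: above s convexity gives D y >= (y / s) D s. *)
Lemma upper_part_le s t x : (0 < s)%R -> t%:E <= D s ->
  (t / s)%:E * upper_part s x <= young_ext D `|f x|.
Proof.
move=> s0 ts; rewrite /upper_part patchE; case: ifPn; last first.
  by move=> _; rewrite mule0 young_ext_ge0.
rewrite inE/=; case: `|f x| => [y| |]//=; last by rewrite leey.
rewrite lte_fin => sy; have y0 := lt_trans s0 sy.
have ys : (1 <= y / s)%R by rewrite ler_pdivlMr// mul1r ltW.
have := young_expand yD ys (ltW s0); rewrite divfK ?gt_eqF//; apply: le_trans.
rewrite -EFinM mulrAC -mulrA mulrC EFinM; apply: lee_wpmul2l => //.
by rewrite lee_fin divr_ge0// ltW.
Qed.

(** By contraposition: if the volume v satisfies v F(T) > 1, then F^-1(1/v) <= T. Truncate at s = 2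
    E(1/v), where D s >= 1/v. The parts of f below and above s both have integral at most s v over
    the cube, so the fractional average is at most 2 s v^(gamma/n) <= 4 T. *)
Lemma box_small (a : 'I_n -> R) (l T : R) : (0 < l)%R -> (0 < T)%R ->
  (4 * T)%:E < ((l ^+ n) `^ (al - 1))%:E * \int[mu]_(x in box a l) `|f x| ->
  (l ^+ n)%:E * F T <= 1.
Proof.
move=> l0 T0; apply: contraPP => /negP; rewrite -ltNge => vF.
apply/negP; rewrite -leNgt; set v := (l ^+ n)%R in vF *.
have v0 : (0 < v)%R by rewrite exprn_gt0.
have t0 : (0 < v^-1)%R by rewrite invr_gt0.
have GT : ginv F (v^-1)%R <= T%:E.
  apply: ginv_le; first exact: ltW.
  by rewrite -[X in X%:E]mulr1 EFinM lte_pdivrMl.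
pose s := (2 * fine (E (v^-1)%R))%R.
have s0 : (0 < s)%R.
  by rewrite mulr_gt0// fine_gt0// E_fun_gt0//= ltey_eq E_fun_fin.
have ts : (v^-1)%:E <= D s by exact: optimal_at_E.
have sT : (s <= 2 * (v `^ (- al) * T))%R.
  rewrite ler_pM2l// -lee_fin fineK ?E_fun_fin// /E_fun EFinM;
    apply: lee_pmul => //.
  - by rewrite lee_fin powR_ge0.
  - exact: ginv_ge0.
  - by rewrite -powR_inv1 ?(ltW v0)// -powRrM mulN1r.
have mb : measurable (box a l) by exact: measurable_box.
have up : \int[mu]_(x in box a l) upper_part s x <= (s * v)%:E.
  have ts0 : (0 < v^-1 / s)%R by rewrite divr_gt0.
  have -> : (s * v = (v^-1 / s)^-1 * 1)%R by rewrite invf_div invrK mulr1.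
  rewrite EFinM lee_pdivlMl// -ge0_integralZl_EFin//; last 3 first.
  - by move=> x _; exact: upper_part_ge0.
  - by apply: measurable_funTS; exact: measurable_upper_part.
  - exact: ltW.
  apply: le_trans int_f; apply: le_trans (ge0_integral_le_setT _ (box a l) _);
    last first.
    by move=> x; rewrite young_ext_ge0.
  apply: ge0_le_lower_integral => x _; last exact: upper_part_le.
  by rewrite mule_ge0 ?upper_part_ge0// lee_fin ltW.
apply: (@le_trans _ _ ((v `^ (al - 1))%:E * (s * v + s * v)%:E)).
  apply: lee_wpmul2l; first by rewrite lee_fin powR_ge0.
  apply: le_trans (integral_box_le_upper a (ltW l0) (ltW s0)) _.
  by rewrite EFinD leeD2l.
rewrite -EFinM lee_fin.
have -> : (v `^ (al - 1) * (s * v + s * v) = 2 * s * v `^ al)%R.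
  rewrite -[in RHS](mulr_powRB1 (ltW v0) al0); ring.
apply: (@le_trans _ _ (2 * (2 * (v `^ (- al) * T)) * v `^ al)%R).
  by rewrite ler_pM2r ?powR_gt0// ler_pM2l.
have -> : (2 * (2 * (v `^ (- al) * T)) * v `^ al = 4 * T * (v `^ (- al) * v `^
  al))%R by ring.
by rewrite powRN mulVf ?mulr1// gt_eqF// powR_gt0.
Qed.

(** As v phi <= 1, the part of f below s contributes at most s v^(gamma/n) <= 2 T, half of 4 T, to
    the average. The part above s then contributes at least 2 T >= s v^(gamma/n), which rearranges
    to the claim. *)
Lemma box_weak (a : 'I_n -> R) (l T phi : R) : (0 < l)%R -> (0 < T)%R ->
    (0 < phi)%R -> F T = phi%:E ->
  (4 * T)%:E < ((l ^+ n) `^ (al - 1))%:E * \int[mu]_(x in box a l) `|f x| ->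
  (l ^+ n)%:E <= \int[mu]_(x in box a l)
     (((2 * T * phi `^ al)^-1)%:E * upper_part (2 * T * phi `^ al) x).
Proof.
move=> l0 T0 phi0 FT big; have := box_small l0 T0 big.
have mb : measurable (box a l) by exact: measurable_box.
move: big; set v := (l ^+ n)%R => big; rewrite FT -EFinM lee_fin => vphi.
have v0 : (0 < v)%R by rewrite exprn_gt0.
set s := (2 * T * phi `^ al)%R.
have s0 : (0 < s)%R by rewrite !mulr_gt0// powR_gt0.
rewrite ge0_integralZl_EFin//; last 3 first.
- by move=> x _; exact: upper_part_ge0.
- by apply: measurable_funTS; exact: measurable_upper_part.
- by rewrite invr_ge0 ltW.
have : (4 * T)%:E < (v `^ (al - 1))%:E *
    ((s * v)%:E + \int[mu]_(x in box a l) upper_part s x).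
  apply: lt_le_trans big _; apply: lee_wpmul2l; first by rewrite lee_fin powR_ge0.
  by apply: integral_box_le_upper; exact: ltW.
have : 0 <= \int[mu]_(x in box a l) upper_part s x.
  by apply: integral_ge0 => x _; exact: upper_part_ge0.
case: (\int[mu]_(x in box a l) upper_part s x) => [I| |]//.
  rewrite lee_fin -EFinD -!EFinM lte_fin lee_fin => I0 h.
  rewrite ler_pdivlMl//.
  have vq0 : (0 < v `^ (al - 1))%R by rewrite powR_gt0.
  have e1 : (v * v `^ (al - 1) = v `^ al)%R by apply: mulr_powRB1 => //; exact: ltW.
  have e2 : (v `^ al * phi `^ al <= 1)%R.
    rewrite -powRM ?(ltW v0) ?(ltW phi0)//; have : ((v * phi) `^ al <= 1 `^ al)%R.
      by apply: ge0_ler_powR => //; rewrite ?nnegrE ?mulr_ge0// ltW.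
    by rewrite powR1.
  have e3 : (s * v `^ al <= 2 * T)%R.
    rewrite /s -mulrA [(phi `^ _ * _)%R]mulrC -[leRHS]mulr1.
    by rewrite ler_pM2l// mulr_gt0.
  have h1 : (4 * T < s * v `^ al + v `^ (al - 1) * I)%R.
    by move: h; rewrite mulrDr mulrCA (mulrC _ v) e1.
  have h2 : (s * v `^ al <= v `^ (al - 1) * I)%R by lra.
  by move: h2; rewrite -e1 mulrA [leRHS]mulrC ler_pM2r.
by move=> _ _; rewrite gt0_muley ?leey// lte_fin invr_gt0.
Qed.

Lemma frac_maximal_gt t x : t%:E < frac_maximal gamma f x ->
  exists (a : 'I_n -> R) (l : R), [/\ (0 < l)%R, box a l x &
    t%:E < ((l ^+ n) `^ (al - 1))%:E * \int[mu]_(y in box a l) `|f y| ].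
Proof.
move=> /ereal_sup_gt[_ [Q [[a [l [l0 QE]]] Qx] <-]].
have {}QE : Q = box a l by [].
rewrite QE [@lebesgue_Rn R n (box a l)]lebesgue_Rn_box; last exact: ltW.
by move=> /= h; exists a, l; split => //; rewrite -QE.
Qed.

(** A cube with a larger average would have |Q| F(T) <= 1 by [box_small], impossible for a positive
    volume. This disposes of the scales at which the weak-type estimate has no finite level. *)
Lemma frac_maximal_le_infty T x : (0 < T)%R -> F T = +oo ->
  frac_maximal gamma f x <= (4 * T)%:E.
Proof.
move=> T0 FT; rewrite leNgt;
  apply/negP => /frac_maximal_gt[a [l [l0 _ /(box_small l0 T0)]]].
by rewrite FT gt0_muley ?leNgt ?ltry// lte_fin exprn_gt0.
Qed.

(** The measurable superset [U] stands in for the superlevel set. *)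
Lemma frac_maximal_weak T phi : (0 < T)%R -> (0 < phi)%R -> F T = phi%:E ->
  exists U : set (Rn R n), [/\ measurable U,
    [set x | (2 ^+ n * (4 * T))%:E < frac_maximal gamma f x] `<=` U &
    mu U <= (3 ^+ n)%:E * \int[mu]_x
      (((2 * T * phi `^ al)^-1)%:E * upper_part (2 * T * phi `^ al) x)].
Proof.
move=> T0 phi0 FT; set s := (2 * T * phi `^ al)%R.
have s0 : (0 < s)%R by rewrite !mulr_gt0// powR_gt0.
(* Enlarging a cube to a rational one costs a factor 2 ^ n in the average and
   leaves a countable family. *)
pose box_ (i : nat) : ('I_n -> R) * R :=
  if unpickle i is Some (q, r)
  then ((fun j => ratr ((q : {ffun 'I_n -> rat}) j)), ratr (r : rat))
  else (fun=> 0%R, 0%R).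
(* The positivity of the side discards the default box of side 0. *)
pose P i := `[< (0 < (box_ i).2)%R /\ (4 * T)%:E <
  (((box_ i).2 ^+ n) `^ (al - 1))%:E * \int[mu]_(x in box (box_ i).1 (box_ i).2)
    `|f x| >].
exists (\bigcup_(i in [set i | P i]) box (box_ i).1 (box_ i).2); split.
- by apply: bigcup_measurable => i _; exact: measurable_box.
- move=> x /= /frac_maximal_gt[a [l [l0 xb big]]].
  have [q [r [/andP[lr rl] sub]]] := rational_box_cover a l0.
  exists (pickle (q, r)); last by rewrite /box_ pickleK/=; exact: sub.
  apply/asboolP; rewrite /box_ pickleK/=.
  have r0 : (0 < ratr r :> R)%R := lt_trans l0 lr.
  split=> //.
  have c0 : (0 < 2 ^+ n :> R)%R by rewrite exprn_gt0.
  rewrite -(@lte_pmul2l _ (2 ^+ n)%:E)// -EFinM; apply: lt_le_trans big _.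
  rewrite muleA -EFinM; apply: lee_pmul.
  + by rewrite lee_fin powR_ge0.
  + exact: integral_ge0.
  + move: (ratr r : R) r0 lr rl {sub} => rr r0 lr rl.
    rewrite lee_fin; apply: (@le_trans _ _ ((2 ^+ n) * (2 ^+ n * l ^+ n) `^ (al -
      1))%R).
      rewrite powRM ?exprn_ge0//; last exact: ltW.
      rewrite mulrA ler_peMl ?powR_ge0// mulr_powRB1 ?(ltW c0)//.
      have : (1 `^ al <= (2 ^+ n) `^ al :> R)%R.
        by rewrite ge0_ler_powR ?nnegrE ?(ltW al0)// ?exprn_ege1// ?ler1n// ltW.
      by rewrite powR1.
    rewrite ler_pM2l// -exprMn -(opprB 1) !powRN lef_pV2 ?posrE ?powR_gt0
      ?exprn_gt0 ?mulr_gt0//.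
    rewrite ge0_ler_powR ?nnegrE ?exprn_ge0 ?mulr_ge0 ?(ltW l0) ?(ltW r0)//.
      by rewrite subr_ge0 ltW.
    by apply: lerXn2r; rewrite ?nnegrE ?mulr_ge0// ltW.
  + apply: ge0_subset_integral => //;
    [exact: measurable_box|exact: measurable_box|].
    exact: measurable_funTS.
- apply: vitali_boxes.
  + apply: measurable_funeM; exact: measurable_upper_part.
  + by move=> x; rewrite mule_ge0 ?upper_part_ge0// lee_fin invr_ge0 ltW.
  + move=> i /asboolP[l0 big]; split; first exact: ltW.
    exact: (box_weak l0 T0 phi0 FT big).
Qed.

End weak_type.

(* Young's inequality for the conjugate exponents q and q / (q - 1). *)
Lemma powR_telescope (R : realType) (q a b : R) : (1 < q)%R -> (0 < a)%R ->
  (0 <= b)%R -> ((a - b) / a `^ (1 - q^-1) <= q * (a `^ q^-1 - b `^ q^-1))%R.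
Proof.
move=> q1 a0 b0; have q0 := lt_trans ltr01 q1.
have al0 : (0 < 1 - q^-1)%R by rewrite subr_gt0 invf_lt1.
rewrite ler_pdivrMr ?powR_gt0// -mulrA mulrBl -powRD;
  last by rewrite (gt_eqF a0) implybT.
rewrite subrKC powRr1; last exact: ltW.
have := @conjugate_powR R (b `^ q^-1)%R (a `^ (1 - q^-1))%R q ((1 - q^-1)^-1)%R.
rewrite !powR_ge0 invr_gt0 invrK subrKC -!powRrM mulVf ?gt_eqF// mulfV ?gt_eqF//.
rewrite !powRr1 ?(ltW a0)// => /(_ isT isT q0 al0 erefl).
move=> /(ler_wpM2l (ltW q0)).
have -> : (q * (b / q + a * (1 - q^-1)) = b + q * a - a)%R by field; rewrite gt_eqF.
move=> h; have -> : (q * (a - b `^ q^-1 * a `^ (1 - q^-1)) =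
  q * a - q * (b `^ q^-1 * a `^ (1 - q^-1)))%R by ring.
lra.
Qed.

(** * Dyadic scales and the telescoping sum *)

Section dyadic.
Context {R : realType}.

Definition dyad (k : int) : R := (2 `^ (k%:~R))%R.

Lemma dyad_gt0 k : (0 < dyad k)%R. Proof. by rewrite powR_gt0. Qed.

Lemma dyadS k : dyad (k + 1) = (2 * dyad k)%R.
Proof.
by rewrite /dyad intrD powRD ?pnatr_eq0 ?implybT// powRr1// mulrC.
Qed.

Lemma dyad_le k l : (k <= l)%R -> (dyad k <= dyad l)%R.
Proof. by move=> kl; rewrite ler_powR ?ler1n// ler_int. Qed.

Lemma dyad_itv (z : R) : (0 < z)%R ->
  exists k, (dyad (k - 1) < z)%R /\ (z <= dyad k)%R.
Proof.
move=> z0; have l2 : (0 < ln 2 :> R)%R by rewrite ln_gt0// ltr1n.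
have zE : z = (2 `^ (ln z / ln 2))%R.
  by rewrite /powR pnatr_eq0/= divfK ?gt_eqF// lnK.
exists (Num.ceil (ln z / ln 2)%R).
have /andP[h1 h2] := real_ceil_itv (num_real (ln z / ln 2)%R).
split; last by rewrite {1}zE ler_powR ?ler1n.
by rewrite {2}zE /dyad /powR pnatr_eq0/= ltr_expR ltr_pM2r.
Qed.

End dyadic.

(** For j < N, [Posz j] and [Negz j] = -(j + 1) run through the integers from -N to N - 1. A sum
    over all scales can thus be a series over [nat] whose partial sums run over consecutive scales
    and telescope. *)
Lemma big_int_sym (V : nmodType) (t : int -> V) N :
  (\sum_(0 <= j < N) (t (Posz j) + t (Negz j)) =
   \sum_(0 <= i < N.*2) t (i%:Z - N%:Z))%R.
Proof.
elim: N => [|N IH]; first by rewrite !big_nil.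
rewrite big_nat_recr//= IH doubleS big_nat_recl// big_nat_recr//=.
rewrite (_ : 0 - N.+1%:Z = Negz N)%R; last by rewrite sub0r NegzE.
rewrite (_ : N.*2.+1%:Z - N.+1%:Z = Posz N)%R; last by lia.
rewrite [LHS]addrC [(t (Posz N) + _)%R]addrC -[LHS]addrA; congr (_ + _)%R.
rewrite [LHS]addrC; congr (_ + _)%R; apply: eq_bigr => i _; congr t; lia.
Qed.

Section dyadic_sum.
Context {R : realType} (n : nat) (gamma : R) (B : R -> \bar R).
Hypotheses (gamma_gt0 : (0 < gamma)%R) (gamma_ltn : (gamma < n%:R)%R).
Hypothesis yB : young_function B.
Hypothesis convB : converges_at_0 n gamma B.
Local Notation p := (crit_exp n gamma).
Local Notation al := (gamma / n%:R)%R.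
Local Notation W := (weighted_integral n gamma B).
Local Notation F := (F_fun n gamma B).
Local Notation D := (optimal_young n gamma B).

Let p1 : (1 < p)%R. Proof. exact: crit_exp_gt1. Qed.
Let p0 : (0 < p)%R. Proof. exact: crit_exp_gt0. Qed.

Definition dyad_F_fun (k : int) : R := fine (F (dyad (k + 1))).
(** The truncation level of the weak-type estimate at T = 2^(k+1). *)
Definition dyad_level (k : int) : R := (2 * dyad (k + 1) * dyad_F_fun k `^ al)%R.
(** The scales that call for the weak-type estimate. If F is infinite, [dyad_F_fun] is the default
    value 0 of [fine], so the coefficient is cut off there. *)
Definition dyad_ok (k : int) := (F (dyad (k + 1)) != +oo) && (B (dyad k) != 0).
Definition dyad_coef (k : int) : R :=
  if dyad_ok k then (fine (B (dyad k)) / dyad_level k)%R else 0%R.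
Definition dyad_W (k : int) : R := (fine (W (dyad k)) `^ p^-1)%R.

Lemma weighted_integral_fin_of_F_fun t : (0 < t)%R -> F t != +oo -> W t \is a
  fin_num.
Proof.
move=> t0 Ft; rewrite ge0_fin_numE ?weighted_integral_ge0// ltey;
  apply: contra Ft => /eqP Wt.
by rewrite /F_fun Wt gt0_muley// lte_fin powR_gt0.
Qed.

Lemma F_fun_dyad_neqy k l : (k <= l)%R -> F (dyad l) != +oo -> F (dyad k) != +oo.
Proof.
move=> kl Fl; rewrite -ltey; move: Fl; rewrite -ltey; apply: le_lt_trans.
by apply: (F_fun_nd gamma_gt0 gamma_ltn yB);
  rewrite ?nnegrE ?(ltW (dyad_gt0 _))// dyad_le.
Qed.

Lemma dyad_ok_facts k : dyad_ok k ->
  [/\ B (dyad k) \is a fin_num, (0 < dyad_F_fun k)%R, (0 < dyad_level k)%R &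
   (dyad_coef k <= p * (dyad_W (k + 1) - dyad_W k))%R].
Proof.
move=> okk; have /andP[Fk Bk] := okk; set x := dyad k in Bk.
have x0 : (0 < x)%R by exact: dyad_gt0.
have x20 : (0 < 2 * x)%R by rewrite mulr_gt0.
have Wf : W (2 * x)%R \is a fin_num by rewrite -dyadS;
  apply: weighted_integral_fin_of_F_fun Fk; exact: dyad_gt0.
have := young_le_weighted_increment gamma_gt0 gamma_ltn yB x0.
set c := (2 `^ (- (p + 1)) * x `^ (- p))%R.
have c0 : (0 < c)%R by rewrite mulr_gt0// powR_gt0.
have Bge := young_ge0 yB (ltW x0); have Wge := weighted_integral_ge0 n gamma yB x.
move=> hW.
have WxF : W x \is a fin_num.
  rewrite ge0_fin_numE//; apply: (@le_lt_trans _ _ (W (2 * x)%R)).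
    by apply: le_trans hW; rewrite leeDr// mule_ge0// lee_fin ltW.
  by rewrite -ge0_fin_numE// weighted_integral_ge0.
have BxF : B x \is a fin_num.
  rewrite ge0_fin_numE// ltey; apply/eqP => Bx.
  move: hW; rewrite Bx gt0_mulye ?lte_fin// addye;
    last by rewrite gt_eqF// (lt_le_trans ltNy0).
  by rewrite leye_eq => /eqP h; move: Wf; rewrite h.
have b0 : (0 < fine (B x))%R by rewrite fine_gt0// lt0e Bk Bge/= -ge0_fin_numE.
have w0 : (0 <= fine (W x))%R by rewrite fine_ge0.
move: hW; rewrite -(fineK BxF) -(fineK WxF) -(fineK Wf) -EFinM -EFinD lee_fin => hW.
set b := fine (B x) in b0 hW; set w := fine (W x) in w0 hW.
set w2 := fine (W (2 * x)%R) in hW.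
have w20 : (0 < w2)%R.
  by apply: lt_le_trans hW; rewrite ltr_pwDl// mulr_gt0.
have FE : dyad_F_fun k = ((2 * x) `^ p * w2)%R by rewrite /dyad_F_fun /F_fun
  dyadS fineM.
have F0 : (0 < dyad_F_fun k)%R by rewrite FE mulr_gt0// powR_gt0.
(* In this form the coefficient is exactly b c / w2^(gamma/n), and b c <= w2 - w, which is what
   [powR_telescope] takes. *)
have LE : dyad_level k = (2 * (2 * x) `^ p * w2 `^ al)%R.
  rewrite /dyad_level FE powRM ?powR_ge0 ?(ltW w20)// dyadS -/x -powRrM.
  have -> : (2 * (2 * x) `^ p = 2 * ((2 * x) * (2 * x) `^ (p * al)))%R.
    rewrite -{1}(crit_exp_ratio gamma_gt0 gamma_ltn) powRD ?powRr1//; last first.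
      by rewrite (gt_eqF x20) implybT.
    exact: ltW.
  ring.
have L0 : (0 < dyad_level k)%R by rewrite LE !mulr_gt0// powR_gt0.
split=> //.
rewrite /dyad_coef okk /dyad_W dyadS -/x -/b -/w -/w2.
apply: le_trans (powR_telescope p1 w20 w0).
rewrite -(crit_exp_conj gamma_gt0 gamma_ltn) subKr.
apply: (@le_trans _ _ (b * c / w2 `^ al)%R); last first.
  by rewrite ler_pM2r ?invr_gt0 ?powR_gt0//; lra.
rewrite le_eqVlt; apply/orP; left; apply/eqP; rewrite LE /c.
rewrite !powRN powRM ?(ltW x0)// powRD ?pnatr_eq0 ?implybT// powRr1//.
field; rewrite !gt_eqF ?powR_gt0//.
Qed.

Lemma dyad_W_nd k : F (dyad (k + 1)) != +oo -> (dyad_W k <= dyad_W (k + 1))%R.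
Proof.
move=> Fk; have Fk' : F (dyad k) != +oo by apply: F_fun_dyad_neqy Fk; rewrite lerDl.
apply: ge0_ler_powR.
- by rewrite invr_ge0 ltW.
- by rewrite nnegrE fine_ge0// weighted_integral_ge0.
- by rewrite nnegrE fine_ge0// weighted_integral_ge0.
apply: fine_le; [exact: weighted_integral_fin_of_F_fun (dyad_gt0 _) Fk'|exact:
  weighted_integral_fin_of_F_fun (dyad_gt0 _) Fk|].
by apply: weighted_integral_nd => //;
  rewrite ?nnegrE ?(ltW (dyad_gt0 _))// dyad_le// lerDl.
Qed.

(** At a point with |f x| = y > 0, the k-th summand of the strong-type bound is y times this
    number. *)
Definition dyad_term (y : R) (k : int) : R :=
  if (dyad_level k < y)%R then dyad_coef k else 0%R.

Lemma dyad_term_le y k : F (dyad (k + 1)) != +oo ->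
  (dyad_term y k <= p * (dyad_W (k + 1) - dyad_W k))%R.
Proof.
move=> Fk; have h0 : (0 <= p * (dyad_W (k + 1) - dyad_W k))%R.
  by rewrite mulr_ge0 ?(ltW p0)// subr_ge0 dyad_W_nd.
rewrite /dyad_term; case: ifP => // _.
have [okk|nok] := boolP (dyad_ok k); first by case: (dyad_ok_facts okk).
by rewrite /dyad_coef (negbTE nok).
Qed.

Lemma sum_dyad_term_le y k m : F (dyad (k + m%:Z)) != +oo ->
  (\sum_(0 <= i < m) dyad_term y (k + i%:Z) <= p * dyad_W (k + m%:Z))%R.
Proof.
elim: m => [_|m IH Fm]; first by rewrite big_nil mulr_ge0 ?powR_ge0// ltW.
have e : (k + m.+1%:Z = k + m%:Z + 1)%R by rewrite -addn1 PoszD addrA.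
rewrite e in Fm *.
have Fm' : F (dyad (k + m%:Z)) != +oo by apply: F_fun_dyad_neqy Fm; rewrite lerDl.
rewrite big_nat_recr//=; apply: le_trans (lerD (IH Fm') (dyad_term_le y Fm)) _.
by rewrite mulrBr subrKC.
Qed.

(** The induction strips vanishing last terms until the last scale K is active, that is, its level
    is below y. Then [optimal_ge_at] at T = 2^(K+1) applies, and its bound dominates the telescoped
    sum over all scales up to K at once. *)
Lemma sum_dyad_term_optimal y k m : (0 < y)%R ->
  (y * \sum_(0 <= i < m) dyad_term y (k + i%:Z))%:E <= p%:E * D (2 * y)%R.
Proof.
move=> y0; have yD : young_function D by exact: optimal_young_young.
elim: m => [|m IH].
  rewrite big_nil mulr0 mule_ge0//; first by rewrite lee_fin ltW.
  by apply: (young_ge0 yD); rewrite mulr_ge0// ltW.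
set K := (k + m%:Z)%R.
have [/andP[okK lK]|nok] := boolP (dyad_ok K && (dyad_level K < y)%R); last first.
  rewrite big_nat_recr//= -/K (_ : dyad_term y K = 0%R) ?addr0//.
  rewrite /dyad_term /dyad_coef; move: nok; rewrite negb_and.
  by case: ifP => // _; case: ifP.
have [_ F0 L0 _] := dyad_ok_facts okK; have /andP[FK _] := okK.
have e : (k + m.+1%:Z = K + 1)%R by rewrite /K -addn1 PoszD addrA.
apply: (@le_trans _ _ (y * (p * dyad_W (K + 1)))%:E).
  rewrite lee_fin ler_pM2l//; have := @sum_dyad_term_le y k m.+1.
  by rewrite e; apply.
rewrite mulrCA EFinM; apply: lee_wpmul2l; first by rewrite lee_fin ltW.
have d0 := @dyad_gt0 R (K + 1).
have FE : F (dyad (K + 1)) = (dyad_F_fun K)%:E.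
  by rewrite /dyad_F_fun fineK// ge0_fin_numE ?F_fun_ge0// ltey.
have Ty : (dyad (K + 1) * dyad_F_fun K `^ al <= y)%R.
  apply: le_trans (ltW lK); rewrite /dyad_level -mulrA ler_peMl ?ler1n//.
  by rewrite mulr_ge0 ?powR_ge0// ltW.
have := optimal_ge_at gamma_gt0 gamma_ltn yB convB d0 F0 FE Ty.
suff -> : (dyad_F_fun K `^ p^-1 / dyad (K + 1) = dyad_W (K + 1))%R by [].
rewrite /dyad_F_fun /F_fun fineM// ?weighted_integral_fin_of_F_fun//= powRM
  ?powR_ge0 ?fine_ge0 ?weighted_integral_ge0//.
rewrite -powRrM mulfV ?gt_eqF// powRr1; last exact: ltW.
by rewrite mulrAC mulfV ?gt_eqF// mul1r.
Qed.

End dyadic_sum.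

(** The supremum of an empty family would be [-oo]; the unit cube with lower corner x excludes
    this. *)
Lemma frac_maximal_ge0 (R : realType) (n : nat) (gamma : R)
    (f : Rn R n -> \bar R) (x : Rn R n) : 0 <= frac_maximal gamma f x.
Proof.
apply: (@le_trans _ _ ((fine (@lebesgue_Rn R n (box (Defs.coord x) 1)) `^
    (gamma / n%:R - 1))%:E * \int[@lebesgue_Rn R n]_(y in box (Defs.coord x) 1)
      `|f y|)).
  by rewrite mule_ge0 ?lee_fin ?powR_ge0// integral_ge0.
apply: ereal_sup_ubound; exists (box (Defs.coord x) 1%R) => //; split.
  by exists (Defs.coord x), 1%R.
by move=> i; rewrite lexx lerDl/=.
Qed.

(** * From the weak-type estimate to the modular inequality *)

Section strong_type.
Context {R : realType} (n : nat) (gamma : R) (B : R -> \bar R).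
Hypotheses (gamma_gt0 : (0 < gamma)%R) (gamma_ltn : (gamma < n%:R)%R).
Hypothesis yB : young_function B.
Hypothesis convB : converges_at_0 n gamma B.
Local Notation p := (crit_exp n gamma).
Local Notation F := (F_fun n gamma B).
Local Notation D := (optimal_young n gamma B).
Local Notation mu := (@lebesgue_Rn R n).
Local Notation dlevel := (dyad_level n gamma B).
Local Notation dcoef := (dyad_coef n gamma B).

Let p1 : (1 < p)%R. Proof. exact: crit_exp_gt1. Qed.
Let p0 : (0 < p)%R. Proof. exact: crit_exp_gt0. Qed.
Let yD : young_function D. Proof. exact: optimal_young_young. Qed.

Variable f : Rn R n -> \bar R.
Hypothesis mf : measurable_fun setT f.
Hypothesis int_f : \int[mu]_x young_ext D (2%:E * `|f x|) <= 1.

Let int_f1 : \int[mu]_x young_ext D `|f x| <= 1.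
Proof.
apply: le_trans int_f; apply: ge0_le_lower_integral => x _.
  by rewrite young_ext_ge0.
by apply: (young_ext_nd yD) => //; rewrite lee_pemull// lee_fin ler1n.
Qed.

Definition dyad_fun (k : int) (x : Rn R n) : \bar R :=
  (dcoef k)%:E * upper_part f (dlevel k) x.

Lemma dyad_coef_ge0 k : (0 <= dcoef k)%R.
Proof.
rewrite /dyad_coef; case: ifPn => // okk.
have [_ _ L0 _] := dyad_ok_facts gamma_gt0 gamma_ltn yB okk.
by rewrite divr_ge0 ?(ltW L0)// fine_ge0// (young_ge0 yB) ?(ltW (dyad_gt0 _)).
Qed.

Lemma dyad_fun_ge0 k x : 0 <= dyad_fun k x.
Proof. by rewrite /dyad_fun mule_ge0 ?upper_part_ge0// lee_fin dyad_coef_ge0. Qed.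

Lemma measurable_dyad_fun k : measurable_fun setT (dyad_fun k).
Proof. by apply: measurable_funeM; exact: measurable_upper_part. Qed.

Lemma sum_dyad_fun_le k m x :
  \sum_(0 <= i < m) dyad_fun (k + i%:Z)%R x <= p%:E * young_ext D (2%:E * `|f x|).
Proof.
have : 0 <= `|f x| by [].
have upE l : upper_part f (dlevel l) x =
    if (dlevel l)%:E < `|f x| then `|f x| else 0.
  by rewrite /upper_part patchE; case: ifPn; rewrite ?inE ?notin_setE/=;
    [move=> ->|move=> /negP/negbTE->].
rewrite le_eqVlt => /predU1P[f0|].
  rewrite big1 ?mule_ge0 ?young_ext_ge0// ?lee_fin ?(ltW p0)//.
  by move=> i _; rewrite /dyad_fun upE -f0 if_same mule0.
under eq_bigr do rewrite /dyad_fun upE.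
case: `|f x| => [y| |]// y0; last by rewrite gt0_muley//= gt0_muley// leey.
rewrite lte_fin in y0.
apply: le_trans (sum_dyad_term_optimal gamma_gt0 gamma_ltn yB convB k m y0).
rewrite EFinM -sumEFin ge0_sume_distrr//; last first.
  by move=> i _; rewrite lee_fin /dyad_term; case: ifP => // _;
    exact: dyad_coef_ge0.
apply: lee_sum => i _; rewrite lte_fin /dyad_term; case: ifP => _.
  by rewrite muleC.
by rewrite !mule0.
Qed.

(** Three cases: where B vanishes the whole space costs nothing; where F is infinite the superlevel
    set is empty; otherwise the weak-type estimate is multiplied by B(2^k). *)
Lemma weak_type_cover k : exists U : set (Rn R n), [/\ measurable U,
  [set x | (2 ^+ n * (4 * dyad (k + 1)))%:E < frac_maximal gamma f x] `<=` U &
  B (dyad k) * mu U <= (3 ^+ n)%:E * \int[mu]_x dyad_fun k x].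
Proof.
have d0 := @dyad_gt0 R (k + 1).
have int0 : 0 <= (3 ^+ n)%:E * \int[mu]_x dyad_fun k x.
  rewrite mule_ge0 ?lee_fin ?exprn_ge0// integral_ge0// => x _; exact: dyad_fun_ge0.
have [B0|Bn0] := eqVneq (B (dyad k)) 0.
  by exists setT; split => //; rewrite B0 mul0e.
have [FT|FT] := eqVneq (F (dyad (k + 1))) +oo.
  exists set0; split => //; last by rewrite measure0 mule0.
  move=> x /=; rewrite ltNge; apply/negP; rewrite negbK.
  apply: le_trans (frac_maximal_le_infty gamma_gt0 gamma_ltn yB convB mf int_f1 x
    d0 FT) _.
  by rewrite lee_fin ler_peMl ?exprn_ege1 ?ler1n// mulr_ge0// ltW.
have okk : dyad_ok n gamma B k by rewrite /dyad_ok FT.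
have [Bf F0 L0 _] := dyad_ok_facts gamma_gt0 gamma_ltn yB okk.
have FE : F (dyad (k + 1)) = (dyad_F_fun n gamma B k)%:E.
  by rewrite /dyad_F_fun fineK// ge0_fin_numE ?F_fun_ge0// ltey.
have [U [mU subU UP]] :=
  frac_maximal_weak gamma_gt0 gamma_ltn yB convB mf int_f1 d0 F0 FE.
exists U; split => //.
have {}UP : mu U <= (3 ^+ n)%:E *
    \int[mu]_x (((dlevel k)^-1)%:E * upper_part f (dlevel k) x) by exact: UP.
have B0 : 0 <= B (dyad k) by apply: (young_ge0 yB); exact/ltW/dyad_gt0.
apply: le_trans (lee_wpmul2l B0 UP) _.
rewrite muleCA lee_wpmul2l ?lee_fin ?exprn_ge0//.
pose g x := ((dlevel k)^-1)%:E * upper_part f (dlevel k) x.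
have mg : measurable_fun setT g.
  by apply: measurable_funeM; exact: measurable_upper_part.
have g0 x : setT x -> 0 <= g x.
  by move=> _; rewrite mule_ge0 ?upper_part_ge0// lee_fin invr_ge0 ltW.
rewrite -(@ge0_integralZl _ _ _ _ _ measurableT g mg _ g0 B0).
rewrite le_eqVlt; apply/orP; left; apply/eqP; apply: eq_integral => x _.
by rewrite /dyad_fun /dyad_coef okk EFinM fineK// muleA.
Qed.

(** 3^n pays for the covering, p for the telescoping. *)
Let K : R := (3 ^+ n * p)%R.
Let K1 : (1 <= K)%R.
Proof. by rewrite mulr_ege1// ?exprn_ege1// ?ler1n// ltW. Qed.
Let K0 : (0 < K)%R := lt_le_trans ltr01 K1.

Lemma frac_maximal_strong :
  \int[mu]_x young_ext B (frac_maximal gamma f x / (2 ^+ n * 16 * K)%:E) <= 1.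
Proof.
have /choice[U UP] := weak_type_cover.
pose t k (x : Rn R n) := (K^-1)%:E * B (dyad k) * (\1_(U k) x)%:E.
have B0 k : 0 <= B (dyad k) by apply: (young_ge0 yB); exact/ltW/dyad_gt0.
have KB0 k : 0 <= (K^-1)%:E * B (dyad k).
  by rewrite mule_ge0// lee_fin invr_ge0 ltW.
have t0 k x : 0 <= t k x by rewrite /t mule_ge0// lee_fin.
have mt k : measurable_fun setT (t k).
  have [mU _ _] := UP k.
  by apply: measurable_funeM; apply/measurable_EFinP; exact: measurable_indic.
pose a j x := t (Posz j) x + t (Negz j) x.
have a0 j x : 0 <= a j x by rewrite adde_ge0.
have ma j : measurable_fun setT (a j) by apply: emeasurable_funD.
have le_series k x : t k x <= \sum_(j <oo) a j x.
  have h j : a j x <= \sum_(j <oo) a j x.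
    apply: le_trans (nneseries_lim_ge j.+1 _); last by move=> i _ _; exact: a0.
    by rewrite big_nat_recr//= leeDr// sume_ge0.
  case: k => j; apply: le_trans (h j); rewrite /a; [exact: leeDl|exact: leeDr].
have le_series_in k x : U k x -> (K^-1)%:E * B (dyad k) <= \sum_(j <oo) a j x.
  move=> Ux; apply: le_trans (le_series k x).
  by rewrite /t indicE mem_set// mule1.
have c0 : (0 < 2 ^+ n * 16 :> R)%R by rewrite mulr_gt0// exprn_gt0.
apply: (@le_trans _ _ (\int[mu]_x (\sum_(j <oo) a j x))).
  apply: ge0_le_lower_integral => x _.
    apply: (young_ext_ge0 yB); rewrite mule_ge0 ?frac_maximal_ge0//.
    by rewrite inve_ge0 lee_fin (ltW (mulr_gt0 c0 K0)).
  have := frac_maximal_ge0 gamma f x.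
  have UPx k : (2 ^+ n * (4 * dyad (k + 1)))%:E < frac_maximal gamma f x -> U k x.
    by case: (UP k) => _ + _; apply.
  have cK := mulr_gt0 c0 K0; rewrite inver gt_eqF//.
  case: (frac_maximal gamma f x) UPx => [r| |]// UPx r0.
    rewrite /= le_eqVlt in r0; case/predU1P: r0 => [[<-]|r0].
      by rewrite /= mul0r (young0 yB); apply: nneseries_ge0 => j _ _; exact: a0.
    rewrite lte_fin in r0.
    (* 16 = 4 * 4: one 4 stands in the level of [weak_type_cover], the other is the ratio of 2^(k+1)
       to 2^(k-1). So z > 2^(k-1) puts x in [U k], while z <= 2^k bounds B z. *)
    pose z := (r / (2 ^+ n * 16))%R.
    have z0 : (0 < z)%R by rewrite divr_gt0.
    have [k [kz zk]] := dyad_itv z0.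
    apply: le_trans (le_series_in k x _); last first.
      apply: UPx; rewrite lte_fin.
      have -> : (k = k - 1 + 1)%R by rewrite subrK.
      rewrite !dyadS; move: kz; rewrite /z ltr_pdivlMr//; apply: le_lt_trans.
      by rewrite le_eqVlt; apply/orP; left; apply/eqP; ring.
    rewrite -EFinM /=; have -> : (r / (2 ^+ n * 16 * K) = K^-1 * z)%R by rewrite
      /z invfM mulrA mulrC.
    apply: le_trans (young_scale yB _ (ltW z0)) _.
      by rewrite invr_ge0 (ltW K0) invf_le1.
    apply: lee_wpmul2l; first by rewrite lee_fin invr_ge0 ltW.
    by apply: (young_nd yB); rewrite ?nnegrE ?(ltW z0) ?(ltW (dyad_gt0 _)).
  (* Where the maximal function is infinite, x lies in every [U k]; as B is unbounded along the
     dyadic scales, the series is infinite too. *)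
  rewrite gt0_mulye ?lte_fin ?invr_gt0//=.
  rewrite leye_eq; apply/eqP/eqyP => M M0.
  have [y y0 My] := young_unbounded yB (K * M)%R.
  have [k [_ yk]] := dyad_itv y0.
  apply: le_trans (le_series_in k x (UPx _ (ltry _))).
  rewrite lee_pdivlMl// -EFinM; apply: le_trans (ltW My) _.
  by apply: (young_nd yB); rewrite ?nnegrE ?(ltW y0) ?(ltW (dyad_gt0 _)).
rewrite integral_nneseries//.
apply: lime_le.
  by apply: is_cvg_nneseries => j _ _; apply: integral_ge0 => x _; exact: a0.
apply: nearW => N.
under eq_bigr do rewrite ge0_integralD//.
rewrite (big_int_sym (fun k => \int[mu]_x t k x)).
have tE k : \int[mu]_x t k x <= (K^-1 * 3 ^+ n)%:E * \int[mu]_x dyad_fun k x.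
  have [mU _ UB] := UP k.
  have m1 : measurable_fun setT (fun x => (\1_(U k) x)%:E : \bar R).
    by apply/measurable_EFinP; exact: measurable_indic.
  have i0 x : setT x -> 0 <= (\1_(U k) x)%:E :> \bar R by rewrite lee_fin.
  rewrite /t (@ge0_integralZl _ _ _ _ _ measurableT _ m1 _ i0 (KB0 k)).
  rewrite integral_indic// setIT EFinM -!muleA lee_wpmul2l//.
  by rewrite lee_fin invr_ge0 ltW.
apply: (@le_trans _ _ (\sum_(0 <= i < N.*2)
   (K^-1 * 3 ^+ n)%:E * \int[mu]_x dyad_fun (i%:Z - N%:Z) x)).
  by apply: lee_sum => i _; exact: tE.
rewrite -ge0_sume_distrr; last first.
  by move=> i _; apply: integral_ge0 => x _; exact: dyad_fun_ge0.
pose h (i : nat) x := dyad_fun (i%:Z - N%:Z)%R x.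
have mh i : measurable_fun setT (h i) by exact: measurable_dyad_fun.
have h0 i x : setT x -> 0 <= h i x by move=> _; exact: dyad_fun_ge0.
pose G x := \sum_(0 <= i < N.*2) h i x.
have G0 x : 0 <= G x by apply: sume_ge0 => i _; exact: h0.
have mG : measurable_fun setT G by apply: emeasurable_sum => i; exact: mh.
rewrite -(@ge0_integral_sum _ _ _ _ _ measurableT _ h mh h0).
have -> : (K^-1 * 3 ^+ n = p^-1)%R.
  by rewrite /K invfM mulrAC mulVf ?mul1r// gt_eqF// exprn_gt0.
have pV0 : 0 <= (p^-1)%:E by rewrite lee_fin invr_ge0 ltW.
rewrite -(@ge0_integralZl _ _ _ _ _ measurableT G mG _ (fun x _ => G0 x) pV0).
apply: le_trans int_f; apply: ge0_le_lower_integral => x _.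
  exact: mule_ge0.
rewrite lee_pdivrMl//; apply: le_trans (sum_dyad_fun_le (- N%:Z)%R N.*2 x).
rewrite /G le_eqVlt; apply/orP; left; apply/eqP; apply: eq_bigr => i _.
by rewrite addrC.
Qed.

End strong_type.

(** * Necessity *)

Lemma frac_maximal_scale (R : realType) (n : nat) (gamma c : R)
    (f : Rn R n -> \bar R) (x : Rn R n) : (0 < c)%R -> measurable_fun setT f ->
  frac_maximal gamma f x <=
    c%:E * frac_maximal gamma (fun y => (c^-1)%:E * f y) x.
Proof.
move=> c0 mf; apply: ge_ereal_sup => _ [Q [cQ Qx] <-].
rewrite -lee_pdivrMl//; apply: ereal_sup_ubound; exists Q => //.
rewrite muleCA; congr (_ * _).
have mQ : measurable Q by case: cQ => a [l [_ ->]]; exact: measurable_box.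
have ma : measurable_fun Q (abse \o f).
  by apply: measurable_funTS; exact: measurableT_comp.
have c1 : 0 <= (c^-1)%:E :> \bar R by rewrite lee_fin invr_ge0 ltW.
rewrite -(@ge0_integralZl _ _ _ _ _ mQ (abse \o f) ma _ (fun y _ => abse_ge0 (f
  y)) c1).
apply: eq_integral => y _; rewrite abseM; congr (_ * _).
by rewrite gee0_abs.
Qed.

Lemma frac_maximal_bounded_optimal (R : realType) (n : nat) (gamma : R)
    (B : R -> \bar R) : (0 < gamma)%R -> (gamma < n%:R)%R -> young_function B ->
  converges_at_0 n gamma B ->
  frac_maximal_bounded n gamma (optimal_young n gamma B) B.
Proof.
move=> g0 gn yB convB; have yD := optimal_young_young g0 gn yB convB.
set D := optimal_young n gamma B.
pose K : R := (2 ^+ n * 16 * (3 ^+ n * crit_exp n gamma))%R.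
have K0 : (0 < K)%R.
  have p0 := crit_exp_gt0 g0 gn.
  apply: mulr_gt0; first by rewrite mulr_gt0// exprn_gt0.
  by apply: mulr_gt0 => //; rewrite exprn_gt0.
exists (2 * K)%R; first by rewrite mulr_gt0.
move=> f [mf _]; have K2 : (0 < 2 * K)%R by rewrite mulr_gt0.
rewrite -lee_pdivrMl//; apply: le_ereal_inf_tmp => _ [l [l0 Dl] <-].
rewrite lee_pdivrMl// -EFinM; apply: ereal_inf_lbound.
exists (2 * K * l)%R => //; split; first by rewrite mulr_gt0.
have l2 : (0 < 2 * l)%R by rewrite mulr_gt0.
(* The divisor is 2 l, not l, because the strong estimate assumes a bound on the modular of 2
   |f'|. *)
pose f' y := ((2 * l)^-1)%:E * f y.
have mf' : measurable_fun setT f' by exact: measurable_funeM.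
have abs_f' y : 2%:E * `|f' y| = `|f y| / l%:E.
  rewrite /f' abseM gee0_abs ?lee_fin ?invr_ge0 ?(ltW l2)// muleA -EFinM.
  by rewrite invfM mulrA mulfV// mul1r inver gt_eqF// muleC.
have := @frac_maximal_strong R n gamma B g0 gn yB convB f' mf'.
have -> : (\int[@lebesgue_Rn R n]_x young_ext D (2%:E * `|f' x|)) =
  orlicz_modular D f l.
  by apply: eq_integral => y _; rewrite abs_f'.
move=> /(_ Dl); apply: le_trans.
have h0 x := @frac_maximal_ge0 R n gamma f x.
have kl : (2 * K * l)%R != 0%R by rewrite gt_eqF// mulr_gt0.
apply: ge0_le_lower_integral => x _.
  by apply: (young_ext_ge0 yB); rewrite mule_ge0// inve_ge0 lee_fin ltW// mulr_gt0.
apply: (young_ext_nd yB);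
  first by rewrite mule_ge0// inve_ge0 lee_fin ltW// mulr_gt0.
rewrite -/K !inver (negbTE kl) gt_eqF// gee0_abs//.
have kl0 : (0 < 2 * K * l)%R by rewrite mulr_gt0.
rewrite (lee_pdivrMr _ _ kl0) -muleA -EFinM.
have -> : (K^-1 * (2 * K * l) = 2 * l)%R by field; rewrite gt_eqF.
by rewrite muleC; exact: frac_maximal_scale.
Qed.

(** * Upper Riemann sums for W on a geometric grid *)

Section weighted_upper.
Context {R : realType} (n : nat) (gamma : R) (B : R -> \bar R).
Hypotheses (gamma_gt0 : (0 < gamma)%R) (gamma_ltn : (gamma < n%:R)%R).
Hypothesis yB : young_function B.
Local Notation leb := (@lebesgue_measure R).
Local Notation p := (crit_exp n gamma).
Local Notation W := (weighted_integral n gamma B).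
Local Notation w := (fun s => B s / (s `^ (p + 1))%:E).
Variables (rho T : R).
Hypotheses (rho1 : (1 < rho)%R) (T0 : (0 < T)%R).

Let rho0 : (0 < rho)%R := lt_trans ltr01 rho1.
Local Notation T_ k := (T * rho^-1 ^+ k)%R.
Let T_gt0 k : (0 < T_ k)%R.
Proof. by rewrite mulr_gt0// exprn_gt0// invr_gt0. Qed.
Let T_le k : (T_ k.+1 <= T_ k)%R.
Proof.
rewrite ler_pM2l// exprS ler_piMl ?exprn_ge0 ?invr_ge0 ?(ltW rho0)//.
by rewrite invf_le1// ltW.
Qed.
Let T_le0 k : (T_ k <= T)%R.
Proof. by elim: k => [|k IH];
  [rewrite expr0 mulr1|exact: le_trans (T_le k) IH]. Qed.

(** On each slice [t, rho t[ B is largest at the right end and the weight at the left end. The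
    length (rho - 1) t times t^(-p-1) equals (rho - 1) rho^p (rho t)^(-p). *)
Lemma weighted_tail_le N : \int[leb]_(s in `[T_ N, T[) w s <=
  ((rho - 1) * rho `^ p)%:E * \sum_(0 <= k < N) B (T_ k) * ((T_ k) `^ (- p))%:E.
Proof.
elim: N => [|N IH].
  by rewrite big_nil mule0 expr0 mulr1 set_itvco0// integral_set0.
have c0 : (0 <= (rho - 1) * rho `^ p)%R by rewrite mulr_ge0 ?powR_ge0// subr_ge0
  ltW.
have B0 k : 0 <= B (T_ k) by exact/(young_ge0 yB)/ltW.
rewrite big_nat_recr//= ge0_muleDr; last 2 first.
- by apply: sume_ge0 => k _; rewrite mule_ge0// lee_fin powR_ge0.
- by rewrite mule_ge0// lee_fin powR_ge0.
have mw (E : set (measurableTypeR R)) : E `<=` `]0%R, +oo[ -> measurable_fun E w.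
  by move=> E0; apply: measurable_funS (measurable_weight n gamma yB).
have -> : `[T_ N.+1, T[%classic = `[T_ N, T[ `|` `[T_ N.+1, T_ N[ :> set
  (measurableTypeR R).
  apply/seteqP; split=> s /=; rewrite !in_itv/=; have := T_le N; have := T_le0 N.
    by move=> h1 h2 /andP[-> ->]; rewrite andbT/=; case: leP; [left|right].
  by move=> h1 h2 []/andP[]; lra.
have pos k s : (T_ k <= s)%R -> (0 < s)%R.
  by move=> h; exact: lt_le_trans (T_gt0 k) h.
rewrite ge0_integral_setU//=; last 3 first.
- by apply: mw => s /= []; rewrite !in_itv/= => /andP[/pos-> _].
- by move=> s /= []; rewrite !in_itv/= => /andP[/pos s0 _]; exact: weight_ge0.
- rewrite disj_set2E; apply/eqP/seteqP; split=> // s /= []; rewrite !in_itv/=; lra.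
apply: leeD IH _.
apply: le_trans (weighted_slice_le gamma_gt0 gamma_ltn yB (T_gt0 _) (T_le N)) _.
rewrite muleCA; apply: lee_wpmul2l => //; rewrite -EFinM lee_fin.
rewrite le_eqVlt; apply/orP; left; apply/eqP.
have -> : (T_ N = rho * T_ N.+1)%R by rewrite exprS mulrCA mulVKf ?gt_eqF.
move: (T_ N.+1) (T_gt0 N.+1) => t t0.
rewrite powRM ?(ltW rho0) ?(ltW t0)// powRD; last by rewrite (gt_eqF t0) implybT.
rewrite powRr1 ?(ltW t0)// !powRN; field.
by rewrite !gt_eqF ?powR_gt0.
Qed.

(** The ratio is left free: the necessity argument takes 2^(n - gamma), the Boyd case a dilation
    factor of B. *)
Lemma weighted_le_of_partial (M : \bar R) :
  (forall N, ((rho - 1) * rho `^ p)%:E *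
     \sum_(0 <= k < N) B (T_ k) * ((T_ k) `^ (- p))%:E <= M) ->
  W T <= M.
Proof.
move=> hM; rewrite /weighted_integral.
have -> : `]0%R, T[%classic = \bigcup_N `[T_ N, T[%classic :> set
  (measurableTypeR R).
  apply/seteqP; split=> s /=.
    rewrite in_itv/= => /andP[s0 sT].
    have q1 : (`|rho^-1| < 1)%R by rewrite ger0_norm ?invr_ge0 ?(ltW rho0)//
      invf_lt1.
    have sT0 : (0 < s / T)%R by rewrite divr_gt0.
    have /cvgr0_norm_le/(_ _ sT0)[N _ hN] := cvg_expr q1.
    exists N => //=; rewrite in_itv/= sT andbT.
    have := hN N (leqnn N); rewrite /= ger0_norm ?exprn_ge0 ?invr_ge0 ?(ltW rho0)//.
    by rewrite ler_pdivlMr// mulrC.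
  by move=> [N _ /=]; rewrite !in_itv/= => /andP[Ns ->];
    rewrite (lt_le_trans (T_gt0 N)).
have mw (E : set (measurableTypeR R)) : E `<=` `]0%R, +oo[ -> measurable_fun E w.
  by move=> E0; apply: measurable_funS (measurable_weight n gamma yB).
have pos k s : (T_ k <= s)%R -> (0 < s)%R.
  by move=> h; exact: lt_le_trans (T_gt0 k) h.
pose I (N : nat) : set (measurableTypeR R) := `[T_ N, T[%classic.
have ndI : nondecreasing_seq I.
  apply/nondecreasing_seqP => N; apply/subsetPset => s.
  by rewrite /I /= !in_itv/= => /andP[Ns ->]; rewrite (le_trans (T_le N) Ns).
have mI N : measurable (I N) by exact: measurable_itv.
have mwI N : measurable_fun (I N) w.
  by apply: mw => s; rewrite /I /= !in_itv/= => /andP[/pos-> _].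
have wI N s : I N s -> 0 <= w s.
  by rewrite /I /= in_itv/= => /andP[/pos s0 _]; exact: weight_ge0.
have cv : \int[leb]_(x in I N) w x @[N --> \oo] -->
    \int[leb]_(x in \bigcup_N I N) w x.
  exact: ge0_nondecreasing_set_cvg_integral.
rewrite -(cvg_lim _ cv)//; apply: lime_le; first by apply/cvg_ex; eexists;
  exact: cv.
by apply: nearW => N; apply: le_trans (weighted_tail_le N) (hM N).
Qed.

End weighted_upper.

(** * Testing the operator on multiples of indicators of cubes *)

Section necessity.
Context {R : realType} (n : nat) (gamma : R) (A B : R -> \bar R).
Hypotheses (gamma_gt0 : (0 < gamma)%R) (gamma_ltn : (gamma < n%:R)%R).
Hypotheses (yA : young_function A) (yB : young_function B).
Local Notation p := (crit_exp n gamma).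
Local Notation al := (gamma / n%:R)%R.
Local Notation W := (weighted_integral n gamma B).
Local Notation F := (F_fun n gamma B).
Local Notation mu := (@lebesgue_Rn R n).

Let p0 : (0 < p)%R. Proof. exact: crit_exp_gt0. Qed.
Let al0 : (0 < al)%R. Proof. exact: ratio_gt0. Qed.
Let al1 : (al < 1)%R. Proof. exact: ratio_lt1. Qed.

Definition dyadic_box (l : R) (k : nat) : set (Rn R n) :=
  box (fun=> 0%R) (2 ^+ k * l)%R.

Definition box_test (y l : R) (x : Rn R n) : \bar R :=
  (y * \1_(dyadic_box l 0) x)%:E.

Lemma measurable_dyadic_box l k : measurable (dyadic_box l k).
Proof. exact: measurable_box. Qed.

Lemma dyadic_box_measure l k : (0 < l)%R ->
  mu (dyadic_box l k) = ((2 ^+ n) ^+ k * l ^+ n)%:E.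
Proof.
move=> l0; rewrite /dyadic_box lebesgue_Rn_box ?mulr_ge0 ?exprn_ge0// ?ltW//.
by rewrite exprMn -!exprM mulnC.
Qed.

Lemma dyadic_boxS l k : (0 < l)%R -> dyadic_box l k `<=` dyadic_box l k.+1.
Proof.
move=> l0 x xb i; have /andP[-> /le_trans h] := xb i; apply: h.
rewrite !add0r ler_pM2r// exprS ler_peMl ?ler1n// exprn_ge0//.
Qed.

Lemma dyadic_box0_sub l k : (0 < l)%R -> dyadic_box l 0 `<=` dyadic_box l k.
Proof.
by move=> l0; elim: k => // k IH; exact: subset_trans IH (dyadic_boxS _).
Qed.

(** Doubling the side multiplies the volume by 2^n >= 2, so a shell is at least as large as the cube
    inside it. *)
Lemma dyadic_shell_measure l k : (0 < l)%R ->
  ((2 ^+ n) ^+ k * l ^+ n)%:E <= mu (dyadic_box l k.+1 `\` dyadic_box l k).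
Proof.
move=> l0.
have n0 : (0 < n)%N by rewrite -(ltr_nat R) (lt_trans gamma_gt0).
have mE k' : mu (dyadic_box l k') = ((2 ^+ n) ^+ k' * l ^+ n)%:E :=
  dyadic_box_measure k' l0.
rewrite [leRHS](@measureD _ _ _ mu); last 3 first.
- exact: measurable_dyadic_box.
- exact: measurable_dyadic_box.
- by rewrite [X in X < _]mE ltry.
rewrite (_ : _ `&` _ = dyadic_box l k); last by apply/setIidr/dyadic_boxS.
rewrite [X in _ <= X - _]mE [X in _ <= _ - X]mE -EFinB lee_fin -mulrBl.
rewrite ler_pM2r ?exprn_gt0// exprS -[X in (_ <= _ - X)%R]mul1r -mulrBl.
rewrite ler_peMl ?exprn_ge0 ?ler0n// lerBrDr.
by rewrite -[leLHS]/(2%:R)%R -[leLHS]expr1 ler_weXn2l// ?ler1n.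
Qed.

Lemma measurable_box_test y l : measurable_fun setT (box_test y l).
Proof.
have m1 : measurable_fun setT (fun x => (\1_(dyadic_box l 0) x)%:E : \bar R).
  by apply/measurable_EFinP/measurable_indic; exact: measurable_dyadic_box.
exact: (measurable_funeM y%:E m1).
Qed.

Lemma box_test_modular y l : (0 < y)%R -> (0 < l)%R ->
  A y <= ((l ^+ n)^-1)%:E -> orlicz_modular A (box_test y l) 1 <= 1.
Proof.
move=> y0 l0; have ln0 : (0 < l ^+ n)%R by exact: exprn_gt0.
move=> Ay.
have m1 : measurable_fun setT (fun x => (\1_(dyadic_box l 0) x)%:E : \bar R).
  by apply/measurable_EFinP/measurable_indic; exact: measurable_dyadic_box.
have i0 x : setT x -> 0 <= (\1_(dyadic_box l 0) x)%:E :> \bar R by rewrite lee_fin.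
have Ay0 := young_ge0 yA (ltW y0).
apply: (@le_trans _ _ (\int[mu]_x (A y * (\1_(dyadic_box l 0) x)%:E))).
  apply: ge0_le_lower_integral => x _.
    by rewrite young_ext_ge0// mule_ge0// inve_ge0.
  rewrite inve1 mule1 /box_test indicE; case: (x \in _) => /=.
    by rewrite mulr1 gtr0_norm// mule1.
  by rewrite mulr0 normr0 mule0 (young0 yA).
rewrite (@ge0_integralZl _ _ _ _ _ measurableT _ m1 _ i0 Ay0).
rewrite integral_indic ?setIT//; last exact: measurable_dyadic_box.
rewrite [X in _ * X](dyadic_box_measure 0 l0) expr0 mul1r.
by rewrite -lee_pdivlMr// mul1e.
Qed.

Lemma frac_maximal_box_test y l k x : (0 < y)%R -> (0 < l)%R ->
  dyadic_box l k x ->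
  ((((2 ^+ n) ^+ k * l ^+ n) `^ (al - 1)) * (y * l ^+ n))%:E <=
    frac_maximal gamma (box_test y l) x.
Proof.
move=> y0 l0 xk; apply: ereal_sup_ubound; exists (dyadic_box l k).
  by split => //; exists (fun=> 0%R), (2 ^+ k * l)%R; rewrite mulr_gt0 ?exprn_gt0.
rewrite [@lebesgue_Rn R n (dyadic_box l k)]dyadic_box_measure//= EFinM;
  congr (_ * _).
have m1 : measurable_fun (dyadic_box l k) (fun x => (\1_(dyadic_box l 0) x)%:E :
  \bar R).
  apply: measurable_funTS.
  by apply/measurable_EFinP/measurable_indic; exact: measurable_dyadic_box.
have i0 x' : dyadic_box l k x' -> 0 <= (\1_(dyadic_box l 0) x')%:E :> \bar R.
  by rewrite lee_fin.
have y00 : 0 <= y%:E by rewrite lee_fin ltW.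
transitivity (\int[mu]_(x in dyadic_box l k) (y%:E * (\1_(dyadic_box l 0) x)%:E)).
  apply: eq_integral => z _; rewrite ger0_norm ?EFinM//.
  by rewrite mulr_ge0// ltW.
rewrite (@ge0_integralZl _ _ _ _ _ (measurable_dyadic_box l k) _ m1 _ i0 y00).
rewrite integral_indic//;
  [|exact: measurable_dyadic_box|exact: measurable_dyadic_box].
rewrite setIidl; last exact: dyadic_box0_sub.
by rewrite [X in _ * X](dyadic_box_measure 0 l0) expr0 mul1r.
Qed.


Lemma shell_sum_le l (b : nat -> \bar R) (h : \bar R) (x : Rn R n) N :
    (0 < l)%R -> 0 <= h -> (forall k, dyadic_box l k.+1 x -> b k <= h) ->
  \sum_(0 <= k < N) b k * (\1_(dyadic_box l k.+1 `\` dyadic_box l k) x)%:E <= h.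
Proof.
move=> l0 h0 bh.
(* The shells are disjoint. The induction needs the stronger claim that the sum vanishes off the
   N-th cube, so that a new shell always meets a zero sum. *)
suff : \sum_(0 <= k < N) b k * (\1_(dyadic_box l k.+1 `\` dyadic_box l k) x)%:E <=
    (if x \in dyadic_box l N then h else 0).
  by move/le_trans; apply; case: ifP.
elim: N => [|N IH]; first by rewrite big_nil; case: ifP.
rewrite big_nat_recr//= [X in _ + _ * X%:E]indicE in_setD.
have [xN|xN] := boolP (x \in dyadic_box l N).
  rewrite xN in IH; rewrite andbF mule0 adde0 ifT//.
  by apply/mem_set/dyadic_boxS => //; exact/set_mem.
rewrite (negbTE xN) in IH; rewrite andbT.
case: ifPn => xN1 /=; last by rewrite mule0 adde0.
by rewrite mule1 -[leRHS]add0e leeD// bh//; exact/set_mem.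
Qed.

Lemma shell_integral_le l (b : nat -> \bar R) (h : Rn R n -> \bar R) N :
    (0 < l)%R -> (forall k, 0 <= b k) -> (forall x, 0 <= h x) ->
    (forall x k, dyadic_box l k.+1 x -> b k <= h x) ->
  \sum_(0 <= k < N) b k * ((2 ^+ n) ^+ k * l ^+ n)%:E <= \int[mu]_x h x.
Proof.
move=> l0 b0 h0 bh.
pose S k := dyadic_box l k.+1 `\` dyadic_box l k.
have mS k : measurable (S k) by apply: measurableD; exact: measurable_dyadic_box.
have m1 k : measurable_fun setT (fun x => (\1_(S k) x)%:E : \bar R).
  exact/measurable_EFinP/measurable_indic.
have i0 k x : setT x -> 0 <= (\1_(S k) x)%:E :> \bar R by rewrite lee_fin.
pose t k x := b k * (\1_(S k) x)%:E.
have mt k : measurable_fun setT (t k) by exact: measurable_funeM.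
have t0 k x : setT x -> 0 <= t k x by move=> _; rewrite /t mule_ge0// lee_fin.
apply: (@le_trans _ _ (\sum_(0 <= k < N) \int[mu]_x t k x)).
  apply: lee_sum => k _.
  rewrite /t (@ge0_integralZl _ _ _ _ _ measurableT _ (m1 k) _ (i0 k) (b0 k)).
  rewrite integral_indic// setIT; apply: lee_wpmul2l => //.
  exact: dyadic_shell_measure.
rewrite -(@ge0_integral_sum _ _ _ _ _ measurableT _ t mt t0).
apply: ge0_le_lower_integral => x _; first by apply: sume_ge0 => k _; exact: t0.
by apply: shell_sum_le => // k; exact: bh.
Qed.

Hypothesis bounded : frac_maximal_bounded n gamma A B.

Lemma F_fun_le_of_bounded : exists2 c : R, (0 < c)%R &
  forall y r : R, (0 < y)%R -> (0 < r)%R -> A y <= r%:E ->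
    F (c * (y * r `^ (- al)))%R <= r%:E.
Proof.
(* Doubling C makes the norm bound strict, so that some admissible lam lies below L. *)
have [C C0 MC] := bounded; pose L : R := (2 * C)%R.
have L0 : (0 < L)%R by rewrite mulr_gt0.
have n0 : (0 < n)%N by rewrite -(ltr_nat R) (lt_trans gamma_gt0).
(* From one dilate to the next the volume is multiplied by 2^n and the fractional average divided by
   rho. As rho^p = 2^n, the sum over shells is a Riemann sum for W on the grid T rho^(-k). *)
pose rho : R := ((2 ^+ n) `^ (1 - al))%R.
have q0 : (0 < 1 - al)%R by rewrite subr_gt0.
have rho1 : (1 < rho)%R.
  have : (1 `^ (1 - al) < rho)%R.
    apply: gt0_ltr_powR => //; rewrite ?nnegrE ?exprn_ge0//.
    by rewrite exprn_egt1// ?ltr1n// -lt0n.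
  by rewrite powR1.
have rho0 : (0 < rho)%R := lt_trans ltr01 rho1.
have rho_p : (rho `^ p = 2 ^+ n)%R.
  rewrite /rho -powRrM crit_exp_conj// mulVf ?gt_eqF// powRr1// exprn_ge0//.
(* Being at least 1, M can be traded for a dilation of the argument by [F_fun_scale]. *)
pose M : R := Num.max 1%R ((rho - 1) * rho `^ p)%R.
have M1 : (1 <= M)%R by rewrite le_max lexx.
have M0 : (0 < M)%R := lt_le_trans ltr01 M1.
exists ((M * rho * L)^-1)%R; first by rewrite invr_gt0 !mulr_gt0.
move=> y r y0 r0 Ay.
(* The cube gets volume 1/r, so that A y <= r bounds the modular by 1. *)
pose l : R := (r `^ (- (n%:R)^-1))%R.
have l0 : (0 < l)%R by rewrite powR_gt0.
have lE : (l ^+ n = r^-1)%R.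
  rewrite -powR_mulrn ?(ltW l0)// -powRrM mulNr mulVf ?pnatr_eq0 -?lt0n//.
  by rewrite powR_inv1// ltW.
have v0 : (0 < l ^+ n)%R by rewrite exprn_gt0.
have modA : orlicz_modular A (box_test y l) 1 <= 1.
  by apply: box_test_modular => //; rewrite lE invrK.
have inA : in_orlicz A (box_test y l).
  split; first exact: measurable_box_test.
  by exists 1%R => //; exact: le_lt_trans modA (ltry _).
have luxA : luxemburg A (box_test y l) <= 1.
  by apply: ereal_inf_lbound; exists 1%R.
have luxB : luxemburg B (frac_maximal gamma (box_test y l)) < L%:E.
  apply: le_lt_trans (MC _ inA) _; apply: (@le_lt_trans _ _ (C%:E * 1)).
    by rewrite lee_wpmul2l// lee_fin ltW.
  by rewrite mule1 lte_fin /L; lra.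
have [_ [lam [lam0 modB] <-] lamL] := ereal_inf_lt luxB.
rewrite lte_fin in lamL.
pose h x := young_ext B (`|frac_maximal gamma (box_test y l) x| / L%:E).
have inv_ge0 (z : R) : (0 < z)%R -> 0 <= z%:E^-1 :> \bar R.
  by move=> z0; rewrite inve_ge0 lee_fin ltW.
have h0 x : 0 <= h x by rewrite young_ext_ge0// mule_ge0// inv_ge0.
have hint : \int[mu]_x h x <= 1.
  apply: le_trans modB; apply: ge0_le_lower_integral => x _ //.
  apply: (young_ext_nd yB); first by rewrite mule_ge0// inv_ge0.
  rewrite lee_wpmul2l// !inver !gt_eqF// lee_fin lef_pV2 ?posrE//.
  exact: ltW.
(* T is the lower bound for the maximal function divided by L on the first dilate. *)
pose T : R := (y * (l ^+ n) `^ al / (rho * L))%R.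
have T0 : (0 < T)%R by rewrite divr_gt0 ?mulr_gt0// powR_gt0.
have T_gt0 k : (0 < T * rho^-1 ^+ k)%R.
  by rewrite mulr_gt0// exprn_gt0// invr_gt0.
pose b k := B (T * rho^-1 ^+ k)%R.
have b0 k : 0 <= b k by apply: (young_ge0 yB); exact/ltW.
have bh x k : dyadic_box l k.+1 x -> b k <= h x.
  move=> xk; have := frac_maximal_box_test y0 l0 xk.
  rewrite /h gee0_abs ?frac_maximal_ge0// inver gt_eqF//.
  have -> : (((2 ^+ n) ^+ k.+1 * l ^+ n) `^ (al - 1) * (y * l ^+ n) =
    T * rho^-1 ^+ k * L)%R.
    rewrite powRM ?(ltW v0) ?exprn_ge0//.
    have -> : (((2 ^+ n) ^+ k.+1) `^ (al - 1) = rho^-1 ^+ k.+1 :> R)%R.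
      rewrite -powR_mulrn ?exprn_ge0// -powRrM mulrC powRrM -opprB powRN.
      by rewrite -/rho powR_mulrn// invr_ge0 ltW.
    rewrite /T -(mulr_powRB1 (ltW v0) al0) exprS; field.
    by rewrite !gt_eqF.
  rewrite EFinM -lee_pdivlMr//.
  by apply: (@young_ext_nd _ _ yB (T * rho^-1 ^+ k)%:E); rewrite lee_fin ltW.
have sumW N : \sum_(0 <= k < N) B (T * rho^-1 ^+ k)%R *
    ((T * rho^-1 ^+ k) `^ (- p))%:E <= (T `^ (- p) * r)%:E.
  have e k : B (T * rho^-1 ^+ k)%R * ((T * rho^-1 ^+ k) `^ (- p))%:E =
      (T `^ (- p) * r)%:E * (b k * ((2 ^+ n) ^+ k * l ^+ n)%:E).
    rewrite muleCA -EFinM; congr (_ * _%:E).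
    rewrite powRM ?(ltW T0) ?exprn_ge0 ?invr_ge0 ?(ltW rho0)// -mulrA;
      congr (_ * _)%R.
    rewrite lE mulrCA mulfV ?gt_eqF// mulr1.
    rewrite (_ : (rho^-1 ^+ k = rho `^ (- k%:R))%R);
      last by rewrite powR_invn ?(ltW rho0)// exprVn.
    by rewrite -powRrM mulrNN mulrC powRrM rho_p powR_mulrn.
  under eq_bigr do rewrite e.
  rewrite -ge0_sume_distrr; last by move=> k _;
    rewrite mule_ge0// lee_fin mulr_ge0 ?exprn_ge0// ltW.
  rewrite -[leRHS]mule1 lee_wpmul2l ?lee_fin ?mulr_ge0 ?powR_ge0 ?(ltW r0)//.
  exact: le_trans (shell_integral_le N l0 b0 h0 bh) hint.
have WT : W T <= (M * (T `^ (- p) * r))%:E.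
  apply: (weighted_le_of_partial gamma_gt0 gamma_ltn yB rho1 T0) => N.
  rewrite [leRHS]EFinM; apply: lee_pmul => //.
  - by rewrite lee_fin mulr_ge0 ?powR_ge0// subr_ge0 ltW.
  - apply: sume_ge0 => k _; apply: mule_ge0; first exact: b0.
    by rewrite lee_fin powR_ge0.
  - by rewrite lee_fin le_max lexx orbT.
have FT : F T <= (M * r)%:E.
  apply: (@le_trans _ _ ((T `^ p)%:E * (M * (T `^ (- p) * r))%:E)).
    by rewrite lee_wpmul2l// lee_fin powR_ge0.
  rewrite -EFinM lee_fin powRN le_eqVlt; apply/orP; left; apply/eqP.
  by field; rewrite gt_eqF// powR_gt0.
have TE : (M * ((M * rho * L)^-1 * (y * r `^ (- al))) = T)%R.
  rewrite /T lE (_ : (r^-1 `^ al = r `^ (- al))%R); last first.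
    by rewrite -(powR_inv1 (ltW r0)) -powRrM mulN1r.
  field.
  by rewrite !gt_eqF.
rewrite -(@lee_pmul2l _ M%:E)// -EFinM; apply: le_trans FT.
rewrite -TE; apply: (F_fun_scale gamma_gt0 gamma_ltn yB M1).
have c0 : (0 < (M * rho * L)^-1)%R by rewrite invr_gt0 !mulr_gt0.
by apply: mulr_ge0; [exact: ltW|apply: mulr_ge0; [exact: ltW|exact: powR_ge0]].
Qed.

End necessity.

(** * The case of a large Boyd index *)

Lemma orlicz_embedding_of_le (R : realType) (n : nat) (A D : R -> \bar R) (k : R) :
    young_function A -> young_function D -> (0 < k)%R ->
    (forall y, (0 < y)%R -> D (k * y)%R <= A y) ->
  orlicz_embedding n A D.
Proof.
move=> yA yD k0 DA.
have ext z : 0 <= z -> young_ext D (k%:E * z) <= young_ext A z.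
  case: z => [y|_|]//; last by rewrite [leRHS]/= leey.
  rewrite lee_fin le_eqVlt => /predU1P[<-|/DA]//.
  by rewrite /= mulr0 (young0 yA) (young0 yD).
have modular (f : Rn R n -> \bar R) l : (0 < l)%R ->
    orlicz_modular D f (l / k) <= orlicz_modular A f l.
  move=> l0; have kl0 : (0 < l / k)%R by rewrite divr_gt0.
  have z0 x : 0 <= `|f x| / l%:E by rewrite mule_ge0// inve_ge0 lee_fin ltW.
  have e x : `|f x| / (l / k)%:E = k%:E * (`|f x| / l%:E).
    by rewrite !inver !gt_eqF// invf_div muleCA EFinM.
  apply: ge0_le_lower_integral => x _; rewrite e; last exact: ext.
  by rewrite (young_ext_ge0 yD)// mule_ge0// lee_fin ltW.
split=> [f [mf [l l0 Al]]|].
  split => //; exists (l / k)%R; first by rewrite divr_gt0.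
  exact: le_lt_trans (modular _ _ l0) Al.
exists (k^-1)%R; first by rewrite invr_gt0.
move=> f _; rewrite lee_pdivlMl//; apply: le_ereal_inf_tmp => _ [l [l0 Al] <-].
rewrite -lee_pdivlMl//; apply: ereal_inf_lbound; exists (l / k)%R.
  split; first by rewrite divr_gt0.
  exact: le_trans (modular _ _ l0) Al.
by rewrite -EFinM mulrC.
Qed.

Lemma optimal_embedding (R : realType) (n : nat) (gamma : R) (A B : R -> \bar R) :
    (0 < gamma)%R -> (gamma < n%:R)%R -> young_function A -> young_function B ->
    converges_at_0 n gamma B -> frac_maximal_bounded n gamma A B ->
  orlicz_embedding n A (optimal_young n gamma B).
Proof.
move=> g0 gn yA yB convB bnd.
have yD := optimal_young_young g0 gn yB convB.
have [c c0 Fc] := F_fun_le_of_bounded g0 gn yA yB bnd.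
have c20 : (0 < c / 2)%R by rewrite divr_gt0.
apply: (orlicz_embedding_of_le n yA yD c20) => y y0.
have key r : (0 < r)%R -> A y <= r%:E -> optimal_young n gamma B (c / 2 * y)%R <=
  r%:E.
  move=> r0 Ay; apply: le_trans (optimal_le g0 gn yB convB _) _.
    by rewrite mulr_gt0.
  apply: ginv_le; first exact: ltW.
  (* Halving c gives the strict inequality c y / 2 < E r required by [ginv]. *)
  apply: (@lt_le_trans _ _ (c * y)%:E).
    by rewrite lte_fin ltr_pM2r// ltr_pdivrMr// mulr_natr mulr2n ltrDl.
  have := ginv_ge (F_fun_nd g0 gn yB) _ (Fc _ _ y0 r0 Ay).
  have z0 : (0 <= c * (y * r `^ (- (gamma / n%:R))))%R.
    by apply: mulr_ge0; [exact: ltW|apply: mulr_ge0; [exact: ltW|exact: powR_ge0]].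
  move=> /(_ z0) h.
  apply: le_trans (lee_wpmul2l _ h); last by rewrite lee_fin powR_ge0.
  rewrite -EFinM lee_fin powRN le_eqVlt; apply/orP; left; apply/eqP.
  by field; rewrite gt_eqF// powR_gt0.
have := young_ge0 yA (ltW y0).
case: (A y) key => [a| |]// key; last by rewrite !leey.
(* [key] needs a positive r, whereas A y may be 0. *)
rewrite lee_fin => a0; apply/lee_addgt0Pr => e e0.
by rewrite -EFinD key ?lee_fin ?lerDl ?(ltW e0)// ltr_wpDl.
Qed.

Lemma converges_of_bounded (R : realType) (n : nat) (gamma : R) (A B : R -> \bar
  R) :
    (0 < gamma)%R -> (gamma < n%:R)%R -> young_function A -> young_function B ->
    frac_maximal_bounded n gamma A B -> converges_at_0 n gamma B.
Proof.
move=> g0 gn yA yB bnd; have [c c0 Fc] := F_fun_le_of_bounded g0 gn yA yB bnd.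
have [y y0 Ay] := young_finite_point yA.
have A0 := young_ge0 yA (ltW y0).
have Af : A y \is a fin_num by rewrite ge0_fin_numE.
have r0 : (0 < fine (A y) + 1)%R by rewrite ltr_wpDl// fine_ge0.
have Ar : A y <= (fine (A y) + 1)%:E by rewrite -[leLHS](fineK Af) lee_fin lerDl.
apply: F_fun_lty_converges (le_lt_trans (Fc _ _ y0 r0 Ar) (ltry _)).
by rewrite mulr_gt0// mulr_gt0// powR_gt0.
Qed.

Lemma ginv_dilate_le (R : realType) (f h : R -> \bar R) (k s : R) : (0 < k)%R ->
  (forall x, (0 <= x)%R -> f x <= h (k * x)%R) -> ginv h s <= k%:E * ginv f s.
Proof.
move=> k0 fh; rewrite -lee_pdivrMl//; apply: le_ereal_inf_tmp => _ [x [x0 sx] <-].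
rewrite lee_pdivrMl// -EFinM; apply: ginv_le; first by rewrite mulr_ge0// ltW.
exact: lt_le_trans sx (fh _ x0).
Qed.

(** * Power growth of B from the lower Boyd index *)

Section boyd_growth.
Context {R : realType} (B : R -> \bar R) (q : R).
Hypotheses (q0 : (0 < q)%R) (yB : young_function B).
Hypothesis boyd : q%:E < lower_boyd B.

Let ginvB_fin s : ginv B s \is a fin_num.
Proof.
have [x x0 sx] := young_unbounded yB s.
rewrite ge0_fin_numE ?ginv_ge0//.
exact: le_lt_trans (ginv_le (ltW x0) sx) (ltry _).
Qed.

Let ginvB_gt0 s : (0 < s)%R -> 0 < ginv B s.
Proof.
move=> s0; have [x x0 Bx] := young_finite_point yB.
have Bf : B x \is a fin_num by rewrite ge0_fin_numE// (young_ge0 yB)// ltW.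
have b0 : (0 <= fine (B x))%R by rewrite fine_ge0// (young_ge0 yB)// ltW.
pose k := Num.min 1%R (s / (fine (B x) + 1))%R.
have b1 : (0 < fine (B x) + 1)%R by rewrite ltr_wpDl.
have k0 : (0 < k)%R by rewrite lt_min ltr01 divr_gt0.
apply: (@lt_le_trans _ _ (k * x)%:E); first by rewrite lte_fin mulr_gt0.
apply: (ginv_ge (young_nd yB)); first by rewrite mulr_ge0// ltW.
apply: le_trans (young_scale yB _ (ltW x0)) _.
  by rewrite (ltW k0)/= ge_min lexx.
rewrite -(fineK Bf) -EFinM lee_fin.
apply: (@le_trans _ _ (s / (fine (B x) + 1) * (fine (B x) + 1))%R).
  by apply: ler_pM => //; [exact: ltW|rewrite ge_min lexx orbT|rewrite lerDl].
by rewrite divfK// gt_eqF.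
Qed.

Lemma dilation_bound : exists t d : R, [/\ (1 < t)%R, (1 <= d)%R, (d `^ q < t)%R &
  forall s, (0 < s)%R -> ginv B (s * t)%R <= d%:E * ginv B s].
Proof.
have [_ [t t1 <-]] := ereal_sup_gt boyd; rewrite /= in t1.
have t0 : (0 < t)%R := lt_trans ltr01 t1.
have ratio s : (0 < s)%R -> ginv B (s * t)%R / ginv B s <= dilation B t.
  by move=> s0; apply: ereal_sup_ubound; exists s.
have d1 : 1 <= dilation B t.
  apply: le_trans (ratio 1%R ltr01); rewrite mul1r.
  have g0 : (0 < fine (ginv B 1))%R by rewrite fine_gt0// ginvB_gt0//= ltey_eq
    ginvB_fin.
  rewrite -[X in _ / X](fineK (ginvB_fin _)) inver gt_eqF// lee_pdivlMr// mul1e.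
  by rewrite fineK ?ginvB_fin// ginv_nd// ltW.
have conclude d : dilation B t = d%:E -> (1 <= d)%R -> forall s, (0 < s)%R ->
    ginv B (s * t)%R <= d%:E * ginv B s.
  move=> dE d1' s s0; have := ratio s s0; rewrite dE.
  have g0 : (0 < fine (ginv B s))%R by rewrite fine_gt0// ginvB_gt0//= ltey_eq
    ginvB_fin.
  by rewrite -[X in _ / X](fineK (ginvB_fin _)) inver gt_eqF// lee_pdivrMr//
    fineK// ginvB_fin.
(* If the dilation is 1 the quotient is infinite by convention, and d = 1 works because 1 < t. *)
case: ifPn => [/eqP dE _|dn1].
  by exists t, 1%R; rewrite powR1; split => //; exact: conclude.
case dE : (dilation B t) => [d| |]; last by rewrite dE in d1.
  rewrite dE lee_fin in d1; rewrite dE eqe in dn1.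
  have d1' : (1 < d)%R by rewrite lt_neqAle eq_sym dn1.
  have ld : (0 < ln d)%R by rewrite ln_gt0.
  have dn0 : (0 < d)%R := lt_trans ltr01 d1'.
  rewrite lne_EFin// inver gt_eqF// -EFinM lte_fin ltr_pdivlMr// => h.
  exists t, d; split => //; last exact: conclude.
  rewrite -[ltRHS](lnK t0) -[ltLHS]lnK ?posrE ?powR_gt0// ltr_expR.
  by rewrite ln_powR.
(* An infinite dilation makes the quotient 0, which does not exceed q. *)
by rewrite /= mule0 lte_fin ltNge (ltW q0).
Qed.

(** h is taken strictly between d and t^(1/q). The slack over d makes B^-1(s t) < h x strict
    whenever s < B x, so some u < h x has B u > s t; staying below t^(1/q) keeps h^q < t. *)
Lemma growth_bound : exists t h : R, [/\ (1 < t)%R, (1 < h)%R, (h `^ q < t)%R &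
  forall x, (0 < x)%R -> t%:E * B x <= B (h * x)%R].
Proof.
have [t [d [t1 d1 dt dP]]] := dilation_bound.
have t0 : (0 < t)%R := lt_trans ltr01 t1.
have d0 : (0 < d)%R := lt_le_trans ltr01 d1.
pose d' := (t `^ q^-1)%R.
have d'q : (d' `^ q = t)%R by rewrite /d' -powRrM mulVf ?gt_eqF// powRr1// ltW.
have dd' : (d < d')%R.
  rewrite ltNge; apply/negP => h; have : (d' `^ q <= d `^ q)%R.
    by apply: ge0_ler_powR; rewrite ?nnegrE ?powR_ge0// ltW.
  by rewrite d'q leNgt dt.
pose h := ((d + d') / 2)%R.
have dh : (d < h)%R by rewrite /h; lra.
have h0 : (0 < h)%R := lt_trans d0 dh.
exists t, h; split => //; first exact: le_lt_trans dh.
  rewrite -d'q; apply: gt0_ltr_powR; rewrite ?nnegrE ?powR_ge0 ?(ltW h0)//.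
  by rewrite /h; lra.
move=> x x0; have hx0 : (0 < h * x)%R by rewrite mulr_gt0.
have key s : (0 < s)%R -> s%:E < B x -> (s * t)%:E <= B (h * x)%R.
  move=> s0 sB.
  have : ginv B (s * t)%R < (h * x)%:E.
    apply: le_lt_trans (dP s s0) _; apply: (@le_lt_trans _ _ (d%:E * x%:E)).
      by rewrite lee_wpmul2l ?lee_fin ?(ltW d0)// ginv_le// ltW.
    by rewrite -EFinM lte_fin ltr_pM2r.
  move=> /ginv_lt[u [u0 uh su]]; apply: le_trans (ltW su) _.
  rewrite lte_fin in uh.
  by apply: (young_nd yB); rewrite ?nnegrE// ltW.
rewrite leNgt; apply/negP => lt.
have Bh0 := young_ge0 yB (ltW hx0); have Bx0 := young_ge0 yB (ltW x0).
(* If the claim failed, some s would fit between B(h x) / t and B x; the latter may be infinite. *)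
have [s [s1 s2]] : exists s : R, B (h * x)%R < (s * t)%:E /\ s%:E < B x.
  move: lt Bh0 Bx0; case: (B (h * x)%R) => [b| |]//; last by rewrite ltNge leey.
  case: (B x) => [c| |]//.
    rewrite -EFinM lte_fin !lee_fin => bc b0 c0; exists ((b / t + c) / 2)%R.
    have bt : (b / t < c)%R by rewrite ltr_pdivrMr// mulrC.
    by rewrite !lte_fin -ltr_pdivrMr//; lra.
  rewrite lee_fin => _ b0 _; exists (b / t + 1)%R.
  by rewrite ltry lte_fin mulrDl divfK ?gt_eqF// ltrDl mul1r.
have s0 : (0 < s)%R.
  by have := le_lt_trans Bh0 s1; rewrite lte_fin pmulr_lgt0.
by have := lt_le_trans s1 (key _ s0 s2); rewrite ltxx.
Qed.

End boyd_growth.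

Section boyd_case.
Context {R : realType} (n : nat) (gamma : R) (B : R -> \bar R).
Hypotheses (gamma_gt0 : (0 < gamma)%R) (gamma_ltn : (gamma < n%:R)%R).
Hypothesis yB : young_function B.
Local Notation p := (crit_exp n gamma).
Local Notation W := (weighted_integral n gamma B).
Local Notation F := (F_fun n gamma B).
Hypothesis boyd : p%:E < lower_boyd B.

Let p0 : (0 < p)%R. Proof. exact: crit_exp_gt0. Qed.

(** On the grid x h^(-k), B decays at least like t^(-k) and the weight grows like h^(p k), so the
    Riemann sum for W is geometric of ratio h^p / t < 1. *)
Lemma F_fun_le_young : exists2 M : R, (1 <= M)%R &
  forall x, (0 < x)%R -> F x <= M%:E * B x.
Proof.
have [t [h [t1 h1 ht hB]]] := growth_bound p0 yB boyd.
have t0 : (0 < t)%R := lt_trans ltr01 t1.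
have h0 : (0 < h)%R := lt_trans ltr01 h1.
pose th := (h `^ p / t)%R.
have hp0 : (0 < h `^ p)%R by rewrite powR_gt0.
have th0 : (0 < th)%R by rewrite divr_gt0.
have th1 : (th < 1)%R by rewrite ltr_pdivrMr// mul1r.
pose C : R := ((h - 1) * h `^ p / (1 - th))%R.
(* The maximum with 1 allows [young_expand] to move the constant into the argument of B. *)
exists (Num.max 1 C)%R; first by rewrite le_max lexx.
move=> x x0.
have B0 k : 0 <= B (x * h^-1 ^+ k)%R.
  by apply: (young_ge0 yB); rewrite mulr_ge0 ?(ltW x0)// exprn_ge0// invr_ge0 ltW.
have decay k : B (x * h^-1 ^+ k)%R <= (t^-1 ^+ k)%:E * B x.
  elim: k => [|k IH]; first by rewrite expr0 mulr1 mul1e.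
  have y0 : (0 < x * h^-1 ^+ k.+1)%R by rewrite mulr_gt0// exprn_gt0// invr_gt0.
  have := hB _ y0; rewrite mulrCA exprS mulVKf ?gt_eqF// => hk.
  rewrite [(t^-1 ^+ _)%R]exprS EFinM -muleA lee_pdivlMl//.
  exact: le_trans hk IH.
have WB : W x <= (C * x `^ (- p))%:E * B x.
  apply: (weighted_le_of_partial gamma_gt0 gamma_ltn yB h1 x0) => N.
  apply: (@le_trans _ _ (((h - 1) * h `^ p)%:E *
     \sum_(0 <= k < N) (x `^ (- p) * th ^+ k)%:E * B x)).
    apply: lee_wpmul2l.
      by rewrite lee_fin mulr_ge0 ?(ltW hp0)// subr_ge0 ltW.
    apply: lee_sum => k _.
    apply: (@le_trans _ _ ((t^-1 ^+ k)%:E * B x * ((x * h^-1 ^+ k) `^ (- p))%:E)).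
      by rewrite lee_wpmul2r// lee_fin powR_ge0.
    rewrite muleAC -EFinM; apply: lee_wpmul2r; first exact/(young_ge0 yB)/ltW.
    rewrite lee_fin powRM ?(ltW x0) ?exprn_ge0 ?invr_ge0 ?(ltW h0)//.
    rewrite (_ : (h^-1 ^+ k = h `^ (- k%:R))%R); last first.
      by rewrite powR_invn ?(ltW h0)// exprVn.
    rewrite -powRrM mulrNN [(k%:R * _)%R]mulrC powRrM powR_mulrn ?(ltW hp0)//.
    by rewrite /th expr_div_n exprVn le_eqVlt; apply/orP; left; apply/eqP; ring.
  rewrite -ge0_sume_distrl; last first.
    by move=> k _; rewrite lee_fin mulr_ge0 ?powR_ge0// exprn_ge0// ltW.
  rewrite muleA; apply: lee_wpmul2r; first exact/(young_ge0 yB)/ltW.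
  rewrite sumEFin -EFinM lee_fin -mulr_sumr mulrCA [leRHS]mulrC.
  rewrite ler_wpM2l ?powR_ge0// /C ler_wpM2l//.
    by rewrite mulr_ge0 ?(ltW hp0)// subr_ge0 ltW.
  have th1' : (0 < 1 - th)%R by rewrite subr_gt0.
  rewrite -[leRHS]mul1r ler_pdivlMr// big_mkord mulrC -opprB mulNr -subrX1 opprB.
  by rewrite gerBl exprn_ge0// ltW.
apply: (@le_trans _ _ ((x `^ p)%:E * ((C * x `^ (- p))%:E * B x))).
  by rewrite lee_wpmul2l// lee_fin powR_ge0.
rewrite muleA -EFinM; apply: lee_wpmul2r; first exact/(young_ge0 yB)/ltW.
rewrite lee_fin mulrCA powRN mulfV ?gt_eqF ?powR_gt0// mulr1.
by rewrite le_max lexx orbT.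
Qed.

Lemma boyd_converges : converges_at_0 n gamma B.
Proof.
have [M M1 FB] := F_fun_le_young; have [x x0 Bx] := young_finite_point yB.
apply: (F_fun_lty_converges (t := x)) => //; apply: le_lt_trans (FB x x0) _.
by rewrite lte_mul_pinfty// ?lee_fin ?(le_trans ler01).
Qed.

Lemma boyd_equiv : equiv_pos (ginv (optimal_young n gamma B))
  (fun t => (t `^ (gamma / n%:R))%:E * ginv B t).
Proof.
have convB := boyd_converges.
have [M M1 FB] := F_fun_le_young; have M0 : (0 < M)%R := lt_le_trans ltr01 M1.
have BF s : ginv B s <= M%:E * ginv F s.
  apply: ginv_dilate_le => // x; rewrite le_eqVlt => /predU1P[<-|x0].
    by rewrite mulr0 F_fun0 (young0 yB).
  exact: le_trans (FB x x0) (young_expand yB M1 (ltW x0)).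
have F_B s : ginv F s <= 4%:E * ginv B s.
  by apply: ginv_dilate_le => // x x0;
    exact: (young_le_F_fun gamma_gt0 gamma_ltn yB).
(* 16 = 4 * 4: one factor from D^-1 <= 4 E, the other from F^-1 <= 4 B^-1. *)
exists (M^-1)%R, 16%R; split; rewrite ?invr_gt0// => t t0.
have a0 : 0 <= (t `^ (gamma / n%:R))%:E by rewrite lee_fin powR_ge0.
split.
  apply: le_trans (E_le_ginv_optimal gamma_gt0 gamma_ltn yB convB t0).
  by rewrite muleCA lee_wpmul2l// lee_pdivrMl.
apply: le_trans (ginv_optimal_le_E gamma_gt0 gamma_ltn yB convB t0) _.
have -> : (16 = 4 * 4 :> R)%R by ring.
rewrite EFinM -muleA lee_wpmul2l// muleCA lee_wpmul2l//.
Qed.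

End boyd_case.

Local Close Scope ereal_scope.

Theorem theorem3p7 (R : realType) (n : nat) (gamma : R) (B : R -> \bar R)
    (gamma_gt0 : 0 < gamma) (gamma_ltn : gamma < n%:R)
    (B_young : young_function B) :
  [/\ converges_at_0 n gamma B ->
        [/\ young_function (optimal_young n gamma B),
            frac_maximal_bounded n gamma (optimal_young n gamma B) B
          & forall A : R -> \bar R, young_function A ->
              frac_maximal_bounded n gamma A B ->
              orlicz_embedding n A (optimal_young n gamma B)],
      ((n%:R / (n%:R - gamma))%:E < lower_boyd B)%E ->
        converges_at_0 n gamma B /\
        equiv_pos (ginv (optimal_young n gamma B))
          (fun t => (t `^ (gamma / n%:R))%:E * ginv B t)%E
    & ~ converges_at_0 n gamma B ->
        ~ exists A : R -> \bar R,
            young_function A /\ frac_maximal_bounded n gamma A B].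
Proof.
split=> [convB|boyd|nconv [A [yA bnd]]].
- split; first exact: optimal_young_young.
    exact: frac_maximal_bounded_optimal.
  by move=> A yA; exact: optimal_embedding.
- by split; [exact: boyd_converges|exact: boyd_equiv].
- by apply: nconv; exact: converges_of_bounded bnd.
Qed.
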